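(* Let $\mu,\nu$ be Radon measures on $\mathbb{R}$, with $\nu$ globally doubling: $\nu(B(x,2r)) \leq C\nu(B(x,r))$ for all $x\in\mathbb{R}$, $r>0$. Write $\mu = \mu_a+\mu_s$ for the Lebesgue decomposition of $\mu$ relative to $\nu$ ($\mu_a\ll\nu$, $\mu_s\perp\nu$). Define $$\mathcal{S}^2_\nu(\mu)(x) = \int_0^1 \alpha^2_{s,\mu,\nu}(B(x,r))\,\frac{dr}{r}, \qquad x\in\mathbb{R},$$ where $B(x,r) = (x-r,x+r)$. Then (a) $\mathcal{S}_\nu(\mu)(x)<\infty$ for $\mu_a$-almost every $x$, and (b) $\mathcal{S}_\nu(\mu)(x) = \infty$ for $\mu_s$-almost every $x$.
   Context: Wasserstein distance: for finite Borel measures $\nu_1,\nu_2$ on $\mathbb{R}$, $\mathbb{W}_1(\nu_1,\nu_2) := \sup_\psi |\int\psi\,d\nu_1 - \int\psi\,d\nu_2|$, the supremum over all $1$-Lipschitz $\psi\colon\mathbb{R}\to\mathbb{R}$ supported on $[0,1]$ (''test functions''). For an interval $I$, $T_I$ is the increasing affine map taking $\overline I$ onto $[0,1]$. Let $\varphi(x) := \operatorname{dist}(x,\mathbb{R}\setminus(0,1))$ and $\varphi_I := \varphi\circ T_I$. Smooth $\alpha$-numbers: $\alpha_{s,\mu,\nu}(I) := \mathbb{W}_1(\mu_{\varphi,I},\nu_{\varphi,I})$ where $\mu_{\varphi,I} := T_{I\sharp}(\mu|_I)/\int\varphi_I\,d\mu$ and $\nu_{\varphi,I} := T_{I\sharp}(\nu|_I)/\int\varphi_I\,d\nu$,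 with $\mu_{\varphi,I}:\equiv 0$ if $\int\varphi_I\,d\mu = 0$ (similarly for $\nu$). *)

(* Defs.v *)
From HB Require Import structures.
From mathcomp Require Import all_boot all_order all_algebra.
From mathcomp Require Import all_classical all_reals all_analysis.
Set Implicit Arguments. Unset Strict Implicit. Unset Printing Implicit Defensive.
Import Order.TTheory GRing.Theory Num.Theory.
Import numFieldNormedType.Exports.
Local Open Scope classical_set_scope.
Local Open Scope ring_scope.

Section defs.
Context {R : realType}.
Notation RT := (measurableTypeR R).

(* Radon measure on R: Borel measure, finite on compact sets (equivalently on
   every compact interval); on R local finiteness implies regularity. *)
Definition radon (mu : {measure set RT -> \bar R}) : Prop :=
  forall a b : R, (mu [set` `[a, b]] < +oo)%E.

Definition doubling (nu : {measure set RT -> \bar R}) : Prop :=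
  exists C : R, forall (x r : R), 0 < r ->
    (nu (ball x (2 * r)) <= C%:E * nu (ball x r))%E.

Definition msingular (mu nu : {measure set RT -> \bar R}) : Prop :=
  exists A : set RT, measurable A /\ mu A = 0%E /\ nu (~` A) = 0%E.

Definition T_I (a b : R) (y : R) : R := (y - a) / (b - a).

Definition phi (t : R) : R := inf [set `|t - y| | y in ~` [set` `]0, 1[]].

Definition test_fun (psi : R -> R) : Prop :=
  (forall x y, `|psi x - psi y| <= `|x - y|) /\
  (forall x, ~ (x \in `[0, 1]) -> psi x = 0).

(* \int psi d mu_{phi,I} for I = (a,b), where
   mu_{phi,I} = T_I#(mu|_I) / \int phi_I dmu  (and := 0 if the denominator is 0);
   the integral against the pushforward is written as \int_I psi (T_I y) dmu(y). *)
Definition int_norm (mu : {measure set RT -> \bar R}) (a b : R) (psi : R -> R)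
  : \bar R :=
  let c := (\int[mu]_y (phi (T_I a b y))%:E)%E in
  if c == 0%E then 0%E
  else ((\int[mu]_(y in `]a, b[) (psi (T_I a b y))%:E) * (fine c)^-1%:E)%E.

(* W_1(mu_{phi,I}, nu_{phi,I}) = smooth alpha number alpha_{s,mu,nu}(I) *)
Definition alpha_s (mu nu : {measure set RT -> \bar R}) (a b : R) : \bar R :=
  ereal_sup [set `|int_norm mu a b psi - int_norm nu a b psi|%E
            | psi in test_fun].

Definition sq_fun (mu nu : {measure set RT -> \bar R}) (x : R) : \bar R :=
  (\int[lebesgue_measure]_(r in `]0%R, 1%R[)
     (alpha_s mu nu (x - r) (x + r) * alpha_s mu nu (x - r) (x + r)
       * (r^-1)%:E))%E.

End defs.

(* Main.v *)
Require Import Defs.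
From HB Require Import structures.
From mathcomp Require Import all_boot all_order all_algebra.
From mathcomp Require Import all_classical all_reals all_analysis.
From mathcomp Require Import measurable_realfun ring lra.
Import Order.TTheory GRing.Theory Num.Theory.
Import numFieldNormedType.Exports.
Local Open Scope classical_set_scope.
Local Open Scope ring_scope.
Set Implicit Arguments. Unset Strict Implicit. Unset Printing Implicit Defensive.

(** Let [hat x r] be the tent function of the ball [B(x, r)], which is twice
    [phi] in the coordinates of that ball, and let [M], [N] be the integrals of
    [hat] against [mu], [nu], and [D = M / N].  The refinement equation
      [hat x r = hat (x - r/2) (r/2) / 2 + hat x (r/2) + hat (x + r/2) (r/2) / 2]
    turns [M] and [N] into weights on a ternary tree on which [D] behaves like a
    martingale, while [M' / M - N' / N], for a node and its child, is controlled
    by the smooth alpha-number of any comparable ball containing the node.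

    Singular part: by concavity [sum M ln (1 + D)] grows along the tree by at
    most a constant times [sum M alpha^2].  Keep only the nodes meeting a set
    [E] on which the square function is bounded: the growth is then bounded, so
    [mu] on [E] cannot concentrate on small neighbourhoods of a [nu]-null set.

    Absolutely continuous part: [sum N D / (1 + D)] decreases along the tree, and
    the decrements dominate [sum N (D' - D)^2] where [D] is bounded.  A Lipschitz
    function integrated against [mu - D nu] telescopes along the tree with a gain
    [2^-m] at depth [m], so alpha-numbers are bounded by these decrements.  Nodes
    with large [D] stay away from the set where [D] is bounded at all scales and
    contribute a convergent sum because alpha-numbers are at most [2]. *)

(** * Hat functions and the refinement tree *)


Section Hat.
Context {R : realType}.
Implicit Types (x y z r p q : R) (X Y : R -> R -> R).

(** The weight that normalises [alpha_s] is the tent itself, so the mass of a ball is, up to the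
    factor 2, the integral of an admissible function. This lets alpha-numbers control ratios of hat
    masses and bounds them by [2] although [mu] is not doubling. Neither the square function nor the
    sets cut out by its size are known to be measurable. Such sets enter only through 0/1 weights on
    nodes, and integration is carried out on finite combinations of hats. The tree is a single grid
    of overlapping nodes: near the centre of the tree every point lies well inside a node of each
    generation, so no shifted dyadic grids are needed. The price is that nodes carry weights instead
    of partitioning the line. The potentials involve [1 + D] rather than [D]: [ln (1 + D)] is
    nonnegative, so nodes may be dropped, and [D / (1 + D)] is at most [1], so the total energy is
    at most a [nu]-mass. Doubling of [nu] enters through the comparability of hat masses and through
    a dichotomy: one vanishing hat mass forces [nu] to vanish. That case is treated apart, since
    densities then have zero denominators. *)

Definition hat x r y : R := Num.max 0 (1 - `|y - x| / r).

Lemma hat_ge0 x r y : 0 <= hat x r y.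
Proof. by rewrite /hat le_max lexx. Qed.

Lemma hat_le1 x r y : 0 < r -> hat x r y <= 1.
Proof.
by move=> r0; rewrite /hat ge_max ler01 lerBlDr lerDl divr_ge0// ltW.
Qed.

Lemma hat_eq0 x r y : 0 < r -> r <= `|y - x| -> hat x r y = 0.
Proof.
move=> r0 ry; rewrite /hat; apply/max_idPl.
by rewrite subr_le0 ler_pdivlMr// mul1r.
Qed.

Lemma hat_neq0_lt x r y : 0 < r -> hat x r y != 0 -> `|y - x| < r.
Proof. by move=> r0; apply: contraNT; rewrite -leNgt => /(hat_eq0 r0) ->. Qed.

Lemma hat_ge x r y : 1 - `|y - x| / r <= hat x r y.
Proof. by rewrite /hat le_max lexx orbT. Qed.

Lemma hat_lip x r y z : 0 < r -> `|hat x r y - hat x r z| <= `|y - z| / r.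
Proof.
move=> r0; wlog le_yz : y z / hat x r z <= hat x r y => [wl|].
  by have [/wl//|/ltW/wl] := leP (hat x r z) (hat x r y); rewrite distrC (distrC z).
rewrite ger0_norm ?subr_ge0// {1}/hat; case: (leP 0 (1 - _)) => h.
  have hz := hat_ge x r z.
  have : `|z - x| / r <= `|y - z| / r + `|y - x| / r.
    rewrite -mulrDl ler_pM2r ?invr_gt0// (distrC y z); exact: ler_distD.
  lra.
rewrite sub0r (le_trans _ (divr_ge0 _ (ltW r0)))// oppr_le0; exact: hat_ge0.
Qed.

Definition refine X x r : R :=
  2^-1 * X (x - r / 2) (r / 2) + X x (r / 2) + 2^-1 * X (x + r / 2) (r / 2).

(** The two-scale relation of the linear B-spline. In the variable [u = (y - x) / r] both sides are
    piecewise linear, so fixing the signs and the branches of the maxima leaves linear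
    arithmetic. *)
Lemma hat_refine y x r : 0 < r -> refine (fun a b => hat a b y) x r = hat x r y.
Proof.
move=> r0; rewrite /refine /hat; set u := (y - x) / r.
have yx : y - x = r * u by rewrite /u mulrC divfK ?gt_eqF.
have E a : `|r * a| / (r / 2) = 2 * `|a|.
  by rewrite normrM gtr0_norm//; field; rewrite gt_eqF.
rewrite (_ : y - (x - r / 2) = r * (u + 1 / 2)); last by rewrite mulrDr -yx; field.
rewrite (_ : y - (x + r / 2) = r * (u - 1 / 2)); last by rewrite mulrDr -yx; field.
rewrite yx !E (_ : `|r * u| / r = `|u|); last by rewrite normrM gtr0_norm//; field; rewrite gt_eqF.
case: (ger0P u) => h1; case: (ger0P (u - 1 / 2)) => h2.
all: case: (ger0P (u + 1 / 2)) => h3.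
all: case: leP => ?; case: leP => ?; case: leP => ?; case: leP => ?; lra.
Qed.

(** A weighted sum over the [3 ^ n] descendants of a node, all of radius [r / 2 ^ n]. Different
    branches may end at the same centre; after merging, a grid point [p] carries the weight
    [hat x r p]. *)
Definition tree n X := iter n refine X.

Lemma treeS n X x r : tree n.+1 X x r = refine (tree n X) x r.
Proof. by []. Qed.

Lemma treeSr n X : tree n.+1 X = tree n (refine X).
Proof. exact: iterSr. Qed.

Lemma treeD n m X : tree (n + m) X = tree n (tree m X).
Proof. by rewrite /tree iterD. Qed.

Lemma half_exp r n : r / 2 / 2 ^+ n = r / 2 ^+ n.+1.
Proof. by rewrite exprS; field; rewrite expf_neq0 ?pnatr_eq0. Qed.

Lemma ler_tree n X Y x r :
  (forall p, X p (r / 2 ^+ n) <= Y p (r / 2 ^+ n)) -> tree n X x r <= tree n Y x r.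
Proof.
elim: n x r => [|n IH] x r h; first by have := h x; rewrite expr0 divr1.
rewrite !treeS /refine; have h' p : tree n X p (r / 2) <= tree n Y p (r / 2).
  by apply: IH => q; rewrite half_exp.
by rewrite !lerD// ler_wpM2l ?invr_ge0.
Qed.

Lemma eq_tree n X Y x r :
  (forall p, X p (r / 2 ^+ n) = Y p (r / 2 ^+ n)) -> tree n X x r = tree n Y x r.
Proof. by move=> h; apply/le_anti/andP; split; apply: ler_tree => p; rewrite h. Qed.

Lemma tree0 n x r : tree n (fun _ _ => 0) x r = 0.
Proof. by elim: n x r => // n IH x r; rewrite treeS /refine !IH; lra. Qed.

Lemma tree_ge0 n X x r : (forall p, 0 <= X p (r / 2 ^+ n)) -> 0 <= tree n X x r.
Proof. by move=> h; rewrite -(tree0 n x r); exact: ler_tree. Qed.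

Lemma treeDl n X Y x r :
  tree n (fun p q => X p q + Y p q) x r = tree n X x r + tree n Y x r.
Proof.
elim: n x r => // n IH x r; rewrite !treeS /refine !IH; lra.
Qed.

Lemma treeZ n c X x r : tree n (fun p q => c * X p q) x r = c * tree n X x r.
Proof. by elim: n x r => // n IH x r; rewrite !treeS /refine !IH; lra. Qed.

(* the scale is constant on each generation of the tree *)
Lemma treeZs n (c : R -> R) X x r :
  tree n (fun p q => c q * X p q) x r = c (r / 2 ^+ n) * tree n X x r.
Proof. by rewrite -treeZ; exact: eq_tree. Qed.

Lemma tree_sum n (I : Type) (s : seq I) (F : I -> R -> R -> R) x r :
  tree n (fun p q => \sum_(i <- s) F i p q) x r = \sum_(i <- s) tree n (F i) x r.
Proof.
elim: s => [|a s IH].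
  rewrite big_nil; transitivity (tree n (fun _ _ => 0) x r); last exact: tree0.
  by apply: eq_tree => p; rewrite big_nil.
rewrite big_cons -IH -treeDl; apply: eq_tree => p; by rewrite big_cons.
Qed.

Lemma tree_hat n y x r : 0 < r -> tree n (fun a b => hat a b y) x r = hat x r y.
Proof.
elim: n x r => // n IH x r r0; rewrite treeS -(@hat_refine y)// /refine !IH//.
all: by rewrite divr_gt0.
Qed.

(** The weight of a grid point obeys the refinement equation of the hat, which drives the induction:
    seen from the three children, the index of [p] is [i + 2 ^ n], [i] and [i - 2 ^ n]. This
    extracts one node from a sum of nonnegative terms. *)
Lemma tree_grid n X x r (i : int) : 0 < r -> (forall p q, 0 <= X p q) ->
  let p := x + i%:~R * (r / 2 ^+ n) in
  hat x r p * X p (r / 2 ^+ n) <= tree n X x r.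
Proof.
move=> + X0; elim: n x r i => [|n IH] x r i r0; cbv zeta.
  (* Generation [0] is the centre alone, and the hat vanishes at every other integer multiple of
     [r]. *)
  rewrite expr0 divr1; have [->|i0] := eqVneq i 0.
    by rewrite mul0r addr0 ler_piMl// hat_le1.
  rewrite hat_eq0 ?mul0r//= (addrC x) addrK normrM (gtr0_norm r0) ler_peMl ?(ltW r0)//.
  by rewrite -intr_norm -[1]/(1%:~R) ler_int -gtz0_ge1 normr_gt0.
rewrite treeS /refine; set p := x + _; set d := r / 2 ^+ n.+1.
have pE : p = x + i%:~R * d by [].
have r20 : 0 < r / 2 by rewrite divr_gt0.
rewrite -(hat_refine p x r0) /refine !mulrDl -!mulrA.
have p2 : r / 2 = (2 ^+ n)%:~R * d.
  by rewrite /d exprS rmorphXn/=; field; rewrite expf_neq0 ?pnatr_eq0.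
have H1 := IH (x - r / 2) _ (i + 2 ^+ n)%R r20.
have H2 := IH x _ i r20.
have H3 := IH (x + r / 2) _ (i - 2 ^+ n)%R r20.
move: H1 H2 H3; cbv zeta; rewrite half_exp -/d !rmorphD/= rmorphN/= !mulrDl mulNr -p2.
rewrite (_ : x - r / 2 + _ = p); last by rewrite pE; lra.
rewrite (_ : x + r / 2 + _ = p); last by rewrite pE; lra.
by move=> H1 H2 H3; rewrite !lerD// ler_wpM2l ?invr_ge0.
Qed.

Lemma tree_grid_near n X x r y : 0 < r -> (forall p q, 0 <= X p q) ->
  exists2 p, `|p - y| <= r / 2 ^+ n / 2 & hat x r p * X p (r / 2 ^+ n) <= tree n X x r.
Proof.
move=> r0 X0; set d := r / 2 ^+ n.
have d0 : 0 < d by rewrite divr_gt0 ?exprn_gt0.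
exists (x + (Num.floor ((y - x) / d + 1 / 2))%:~R * d); last exact: tree_grid.
set t := (y - x) / d.
have -> : y = x + t * d by rewrite /t divfK ?gt_eqF//; lra.
rewrite opprD addrACA subrr add0r -mulrBl normrM (gtr0_norm d0) mulrC ler_pM2l//.
have := floor_le_tmp (t + 1/2); have := floorD1_gt (t + 1/2).
rewrite rmorphD /= => h1 h2; rewrite ler_norml; apply/andP; split; lra.
Qed.

End Hat.

(** * Masses of hat functions *)


Section Mass.
Context {R : realType}.
Implicit Types (x y z r p q : R) (X Y : R -> R -> R).
Notation RT := (measurableTypeR R).
Implicit Types mu nu : {measure set RT -> \bar R}.

Lemma measurable_hat x r : measurable_fun [set: RT] (hat x r : RT -> R).
Proof.
apply: measurable_maxr => //; apply: measurable_funB => //.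
apply: measurable_funM => //; apply: measurableT_comp => //; exact: measurable_funB.
Qed.

Lemma radon_ball mu x r : radon mu -> (mu (ball x r) < +oo)%E.
Proof.
move=> /(_ (x - r) (x + r)); apply: le_lt_trans; rewrite ball_itv.
apply: le_measure; rewrite ?inE; try exact: measurable_itv.
by apply: subset_itv; rewrite bnd_simp.
Qed.

Lemma measurable_ball x r : measurable (ball x r : set RT).
Proof. by rewrite ball_itv; exact: measurable_itv. Qed.

Lemma hat_indic x r y : 0 < r -> hat x r y <= \1_(ball x r) y.
Proof.
move=> r0; rewrite indicE; have [yx|] := ltP `|y - x| r.
  by rewrite mem_set ?hat_le1// /ball/= distrC.
by move=> /(hat_eq0 r0) ->.
Qed.

Lemma integral_hat_le mu x r : 0 < r ->
  (\int[mu]_y (hat x r y)%:E <= mu (ball x r))%E.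
Proof.
move=> r0; rewrite -[X in (_ <= mu X)%E]setIT -integral_indic//; last exact: measurable_ball.
apply: ge0_le_integral => //.
- by move=> y _; rewrite lee_fin hat_ge0.
- by apply/measurable_EFinP; exact: measurable_hat.
- by apply/measurable_EFinP; apply: measurable_indic; exact: measurable_ball.
- by move=> y _; rewrite lee_fin hat_indic.
Qed.

Lemma integrable_hat mu x r : radon mu -> 0 < r ->
  mu.-integrable setT (EFin \o hat x r).
Proof.
move=> rmu r0; apply/integrableP; split.
  by apply/measurable_EFinP; exact: measurable_hat.
apply: le_lt_trans (radon_ball x r rmu); apply: le_trans (integral_hat_le mu x r0).
rewrite le_eqVlt; apply/orP; left; apply/eqP; apply: eq_integral => y _ /=.
by rewrite ger0_norm ?hat_ge0.
Qed.

Lemma integrable_dom_hat mu x r c (f : RT -> R) : radon mu -> 0 < r ->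
  measurable_fun setT f -> (forall y, `|f y| <= c * hat x r y) ->
  mu.-integrable setT (EFin \o f).
Proof.
move=> rmu r0 mf fle; apply: (@le_integrable _ _ _ mu setT _ _
  (EFin \o (fun y => c * hat x r y))) => //.
- exact/measurable_EFinP.
- move=> y _ /=; rewrite lee_fin; apply: le_trans (fle y) _; exact: ler_norm.
- exact: (integrableZl measurableT c (integrable_hat x rmu r0)).
Qed.

Definition hmass mu x r : R := \int[mu]_y hat x r y.

Lemma EFin_hmass mu x r : radon mu -> 0 < r ->
  (hmass mu x r)%:E = (\int[mu]_y (hat x r y)%:E)%E.
Proof.
by move=> rmu r0; rewrite /hmass /Rintegral fineK//; apply: integrable_fin_num => //;
   exact: integrable_hat.
Qed.

Lemma hmass_ge0 mu x r : 0 <= hmass mu x r.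
Proof. by apply: Rintegral_ge0 => y _; rewrite hat_ge0. Qed.

Lemma hmass_le_ball mu x r : radon mu -> 0 < r -> ((hmass mu x r)%:E <= mu (ball x r))%E.
Proof. by move=> rmu r0; rewrite EFin_hmass//; exact: integral_hat_le. Qed.

(** The hat is at least [1/2] on the concentric ball of half the radius. *)
Lemma ball_le_hmass mu x r : radon mu -> 0 < r ->
  (mu (ball x (r / 2)) <= (2 * hmass mu x r)%:E)%E.
Proof.
move=> rmu r0; rewrite EFinM EFin_hmass// -ge0_integralZl//; last 2 first.
- by apply/measurable_EFinP; exact: measurable_hat.
- by move=> y _; rewrite lee_fin hat_ge0.
rewrite -[X in (mu X <= _)%E]setIT -integral_indic//; last exact: measurable_ball.
apply: ge0_le_integral => //.
- by apply/measurable_EFinP; apply: measurable_indic; exact: measurable_ball.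
- by apply/measurable_EFinP; apply: measurable_funM => //; exact: measurable_hat.
move=> y _; rewrite -EFinM lee_fin indicE; case: (boolP (y \in _)) => [|_].
  rewrite inE /ball/= distrC => yx; have := hat_ge x r y.
  have : `|y - x| / r <= 2^-1 by rewrite ler_pdivrMr// mulrC ltW.
  rewrite /=; lra.
by rewrite mulr_ge0 ?hat_ge0.
Qed.

Lemma integral_refine mu (F : RT -> R -> R -> R) x r :
  (forall y p q, 0 <= F y p q) ->
  (forall p q, measurable_fun [set: RT] (fun y => F y p q)) ->
  (\int[mu]_y (refine (F y) x r)%:E =
  2^-1%:E * (\int[mu]_y (F y (x - r / 2) (r / 2))%:E) +
  (\int[mu]_y (F y x (r / 2))%:E) + 2^-1%:E * (\int[mu]_y (F y (x + r / 2) (r / 2))%:E))%E.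
Proof.
move=> F0 mF; have mE p q : measurable_fun setT (EFin \o (fun y : RT => F y p q)).
  exact/measurable_EFinP.
have mZ p q : measurable_fun setT (EFin \o (fun y : RT => 2^-1 * F y p q)).
  by apply/measurable_EFinP; apply: measurable_funM.
under eq_integral do rewrite /refine !EFinD.
have Z p q : (\int[mu]_y (2^-1 * F y p q)%:E = 2^-1%:E * \int[mu]_y (F y p q)%:E)%E.
  rewrite -ge0_integralZl//; first exact: mE.
  by move=> y _; rewrite lee_fin.
have h0 : 0 <= 2^-1 :> R by rewrite invr_ge0.
have Z0 p q y : (0 <= (2^-1 * F y p q)%:E)%E by rewrite lee_fin mulr_ge0.
have F0' p q y : (0 <= (F y p q)%:E)%E by rewrite lee_fin.
rewrite (@ge0_integralD _ _ _ mu setT _ (fun y => (2^-1 * F y (x - r / 2) (r / 2))%:E +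
   (F y x (r / 2))%:E)%E) ?(@ge0_integralD _ _ _ mu setT _
   (fun y => (2^-1 * F y (x - r / 2) (r / 2))%:E)) ?Z//.
all: try exact: mE.
all: try exact: mZ.
- by move=> y _; rewrite adde_ge0.
- exact: (emeasurable_funD (mZ _ _) (mE _ _)).
Qed.

Lemma measurable_tree n (F : RT -> R -> R -> R) x r :
  (forall p q, measurable_fun [set: RT] (fun y => F y p q)) ->
  measurable_fun [set: RT] (fun y => tree n (F y) x r).
Proof.
move=> mF; elim: n x r => // n IH x r; rewrite /tree/= /refine.
apply: measurable_funD; first apply: measurable_funD; rewrite //.
all: by [exact: IH | apply: measurable_funM => //; exact: IH].
Qed.

Lemma measurable_tree_hat n (c : R -> R -> R) x r :
  measurable_fun [set: RT] (fun y => tree n (fun p q => c p q * hat p q y) x r).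
Proof.
apply: (@measurable_tree n (fun y p q => c p q * hat p q y)) => p q.
by apply: measurable_funM => //; exact: measurable_hat.
Qed.

Lemma tree_hat_ge0 n (c : R -> R -> R) x r y : (forall p q, 0 <= c p q) ->
  0 <= tree n (fun p q => c p q * hat p q y) x r.
Proof. by move=> c0; apply: tree_ge0 => p; rewrite mulr_ge0// hat_ge0. Qed.

(** Reduces estimates of weighted sums of masses to estimates at a fixed point [y], where only the
    nodes containing [y] contribute. *)
Lemma integral_tree mu n (c : R -> R -> R) x r : radon mu -> 0 < r ->
  (forall p q, 0 <= c p q) ->
  (\int[mu]_y (tree n (fun p q => c p q * hat p q y) x r)%:E =
   (tree n (fun p q => c p q * hmass mu p q) x r)%:E)%E.
Proof.
move=> rmu + c0; elim: n x r => [|n IH] x r r0.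
  rewrite /tree/= EFinM EFin_hmass// -ge0_integralZl//.
  - by apply/measurable_EFinP; exact: measurable_hat.
  - by move=> y _; rewrite lee_fin hat_ge0.
  - by rewrite lee_fin.
rewrite treeS (@integral_refine mu (fun y => tree n (fun p q => c p q * hat p q y)));
  last 2 first.
- by move=> y p q; exact: tree_hat_ge0.
- by move=> p q; exact: measurable_tree_hat.
by rewrite !IH ?divr_gt0// /refine -!EFinM -!EFinD.
Qed.

Lemma tree_hmass mu n x r : radon mu -> 0 < r -> tree n (hmass mu) x r = hmass mu x r.
Proof.
move=> rmu r0; apply: EFin_inj.
transitivity (tree n (fun p q => 1 * hmass mu p q) x r)%:E.
  by congr EFin; apply: eq_tree => p; rewrite mul1r.
rewrite -integral_tree// EFin_hmass//; apply: eq_integral => y _; congr EFin.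
rewrite -[RHS](tree_hat n)//; apply: eq_tree => p; by rewrite mul1r.
Qed.

Lemma hmass_refine mu x r : radon mu -> 0 < r -> refine (hmass mu) x r = hmass mu x r.
Proof. by move=> rmu r0; exact: (@tree_hmass _ 1). Qed.

(** [A] need not be measurable: the null set is the intersection of measurable covers of measure at
    most [1 / (n + 1)]. *)
Lemma negligible_small mu (A : set RT) :
  (forall e, 0 < e -> exists B, [/\ measurable B, A `<=` B & (mu B <= e%:E)%E]) ->
  mu.-negligible A.
Proof.
move=> h; have h' n : exists B, [/\ measurable B, A `<=` B & (mu B <= (n.+1%:R^-1)%:E)%E].
  by apply: h; rewrite invr_gt0.
have [B /all_and3[mB AB Bn]] := choice h'.
exists (\bigcap_n B n); split; first exact: bigcapT_measurable.
  apply/eqP; rewrite eq_le measure_ge0 andbT; apply/lee_addgt0Pr => e e0.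
  rewrite add0e; have [n ne] : exists n, n.+1%:R^-1 < e.
    exists (Num.truncn e^-1); rewrite -[ltRHS]invrK ltf_pV2 ?posrE ?invr_gt0//.
    exact: truncnS_gt.
  apply: le_trans (le_trans (Bn n) _); last by rewrite lee_fin ltW.
  apply: le_measure; rewrite ?inE//; first exact: bigcapT_measurable.
  exact: bigcap_inf.
by move=> y Ay n _; exact: AB.
Qed.

End Mass.

(** * Covering and regularity *)


Section Covering.
Context {R : realType}.
Implicit Types (x y z r p q : R).
Notation RT := (measurableTypeR R).
Implicit Types mu nu : {measure set RT -> \bar R}.

Lemma arg_min_seq (T : eqType) (f : T -> R) (s : seq T) : s != [::] ->
  exists2 a, a \in s & forall b, b \in s -> f a <= f b.
Proof.
elim: s => // a [|b s] IH _.
  by exists a; rewrite ?mem_head// => b; rewrite inE => /eqP ->.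
have [//|c cs cmin] := IH; have [ac|ca] := leP (f a) (f c).
  exists a; rewrite ?mem_head// => d; rewrite inE => /orP[/eqP ->//|/cmin].
  exact: le_trans.
exists c; first by rewrite inE cs orbT.
by move=> d; rewrite inE => /orP[/eqP ->|/cmin//]; exact: ltW.
Qed.

Lemma ball_ltE x r y : ball x r y = (x - r < y /\ y < x + r) :> Prop.
Proof. by rewrite ball_itv/= in_itv/=; apply/propext; split => /andP. Qed.

(** On the line, intervals through a common point [y] are all covered by the one reaching furthest
    left and the one reaching furthest right. Any third interval is therefore redundant. *)
Lemma three_balls (t : seq (R * R)) y : uniq t -> (2 < size t)%N ->
  (forall i, i \in t -> ball i.1 i.2 y) ->
  exists i, i \in t /\
    forall z, ball i.1 i.2 z -> exists j, [/\ j \in t, j != i & ball j.1 j.2 z].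
Proof.
move=> ut t2 ty; have t0 : t != [::] by case: t t2 {ut ty}.
have [a at_ amin] := @arg_min_seq _ (fun i : R * R => i.1 - i.2) _ t0.
have [b bt bmax] := @arg_min_seq _ (fun i : R * R => - (i.1 + i.2)) _ t0.
have [i it] : exists2 i, i \in t & i \notin [:: a; b].
  apply: contrapT => /forall2NP h; have : {subset t <= [:: a; b]}.
    by move=> i it; have [//|/negP] := h i; rewrite negbK.
  by move=> /(uniq_leq_size ut) /=; rewrite leqNgt t2.
rewrite !inE negb_or => /andP[ia ib]; exists i; split => // z; rewrite ball_ltE => -[z1 z2].
have := ty _ at_; have := ty _ bt; rewrite !ball_ltE => -[yb1 yb2] [ya1 ya2].
have ami := amin _ it; have bmi := bmax _ it; rewrite lerN2 in bmi.
have [yz|zy] := leP y z.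
  exists b; rewrite bt eq_sym ib ball_ltE; split => //; split; first exact: lt_le_trans yz.
  exact: lt_le_trans z2 _.
exists a; rewrite at_ eq_sym ia ball_ltE; split => //; split; first exact: le_lt_trans z1.
exact: lt_trans ya2.
Qed.

(** Induction on the size of the family: duplicates and balls covered by the others are discarded
    without changing the union. In a family that cannot be reduced further every point lies in at
    most two balls, whence the factor [2], with no doubling assumption. *)
Lemma cover_finite mu nu c x0 r0 (s : seq (R * R)) : 0 <= c ->
  (forall i, i \in s -> ball i.1 i.2 `<=` ball x0 r0) ->
  (forall i, i \in s -> (mu (ball i.1 i.2) <= c%:E * nu (ball i.1 i.2))%E) ->
  (mu (\big[setU/set0]_(i <- s) ball i.1 i.2) <= (2 * c)%:E * nu (ball x0 r0))%E.
Proof.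
move=> c0; have [n] := ubnP (size s); elim: n s => // n IH s sn sB sle.
have [us|] := boolP (uniq s); last first.
  rewrite -(ltn_size_undup s) => us.
  have -> : \big[setU/set0]_(i <- s) ball i.1 i.2 =
      \big[setU/set0]_(i <- undup s) ball i.1 i.2 :> set RT.
    by rewrite -!bigcup_seq; apply: eq_bigcupl; split => i /=; rewrite mem_undup.
  apply: IH; first exact: leq_trans us _.
    by move=> i; rewrite mem_undup; exact: sB.
  by move=> i; rewrite mem_undup; exact: sle.
have [[i [is_ icov]]|noi] := pselect (exists i, i \in s /\ forall z, ball i.1 i.2 z ->
    exists j, [/\ j \in s, j != i & ball j.1 j.2 z]).
  have -> : \big[setU/set0]_(i <- s) ball i.1 i.2 =
      \big[setU/set0]_(i <- rem i s) ball i.1 i.2 :> set RT.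
    rewrite -!bigcup_seq; apply/seteqP; split => z [j /= js zj].
      have [ji|ji] := eqVneq j i; last by exists j => //=; rewrite mem_rem_uniq// inE ji.
      have [k [ks ki zk]] := icov z (eq_ind _ (fun j => ball j.1 j.2 z) zj _ ji).
      by exists k => //=; rewrite mem_rem_uniq// inE ki.
    by exists j => //=; exact: mem_rem js.
  apply: IH; first by rewrite size_rem//; case: (s) is_ sn.
    by move=> j /mem_rem; exact: sB.
  by move=> j /mem_rem; exact: sle.
(* From here on the family is irreducible, and the overlap bound is read off by integrating the sum
   of the indicators. *)
have mb (i : R * R) : measurable (ball i.1 i.2 : set RT) by exact: measurable_ball.
apply: (@le_trans _ _ (\sum_(i <- s) mu (ball i.1 i.2))%E).
  elim: (s) => [|i t IHt]; first by rewrite !big_nil measure0.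
  rewrite !big_cons; apply: le_trans (measureU2 _ _ _) (leeD2l _ IHt) => //.
  exact: bigsetU_measurable.
apply: (@le_trans _ _ (c%:E * \sum_(i <- s) nu (ball i.1 i.2))%E).
  rewrite ge0_sume_distrr//; rewrite big_seq [leRHS]big_seq; exact: lee_sum.
rewrite mulrC EFinM -muleA; apply: lee_wpmul2l => //.
have mi (A : set RT) : measurable A -> measurable_fun setT (EFin \o (\1_A : RT -> R)).
  by move=> mA; apply/measurable_EFinP; exact: measurable_indic.
have E (A : set RT) : measurable A -> nu A = (\int[nu]_y (\1_A y)%:E)%E.
  by move=> mA; rewrite integral_indic// setIT.
under eq_bigr do rewrite E//.
rewrite -(@ge0_integral_sum _ _ _ nu setT measurableT _
  (fun (i : R * R) y => (\1_(ball i.1 i.2 : set RT) y)%:E))//; last first.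
  by move=> i; exact: mi.
have mB0 : measurable (ball x0 r0 : set RT) by exact: measurable_ball.
rewrite (E (ball x0 r0))// -ge0_integralZl//; last exact: mi.
apply: ge0_le_integral => //.
- by move=> y _; apply: sume_ge0 => i _; rewrite lee_fin.
- by apply: emeasurable_sum => i; exact: mi.
- by apply: emeasurable_funM => //; exact: mi.
move=> y _; rewrite sumEFin -EFinM lee_fin.
set b := fun i : R * R => y \in (ball i.1 i.2 : set RT).
have -> : \sum_(i <- s) \1_(ball i.1 i.2 : set RT) y = (size (seq.filter b s))%:R :> R.
  rewrite size_filter -sum1_count natr_sum [RHS]big_mkcond/=; apply: eq_bigr => i _.
  by rewrite indicE -/(b i); case: (b i).
have tin i : i \in seq.filter b s -> i \in s /\ ball i.1 i.2 y.
  by rewrite mem_filter /b => /andP[/set_mem].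
have t2 : (size (seq.filter b s) <= 2)%N.
  rewrite leqNgt; apply/negP => t3; apply: noi.
  have [|i [it icov]] := @three_balls _ y (seq.filter_uniq b us) t3.
    by move=> i /tin[].
  have [is_ _] := tin _ it; exists i; split => // z /icov [j [/tin[js _] ji zj]].
  by exists j.
move: tin t2; case: (seq.filter b s) => [|i t] tin t2; first by rewrite mulr_ge0.
have [/sB iB0 yi] := tin _ (mem_head _ _).
by rewrite indicE mem_set ?mulr1 ?ler_nat//; exact: iB0.
Qed.

(** An arbitrary family is first made countable: for each pair of rationals whose open interval fits
    in some ball of the family, one such ball is chosen. These have the same union, and continuity
    from below reduces to [cover_finite]. *)
Lemma cover_bigcup mu nu c x0 r0 (I : set (R * R)) : 0 <= c ->
  (forall i, I i -> ball i.1 i.2 `<=` ball x0 r0) ->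
  (forall i, I i -> (mu (ball i.1 i.2) <= c%:E * nu (ball i.1 i.2))%E) ->
  (mu (\bigcup_(i in I) ball i.1 i.2) <= (2 * c)%:E * nu (ball x0 r0))%E.
Proof.
move=> c0 IB Ile.
pose Q (ab : rat * rat) (i : R * R) :=
  I i /\ `](ratr ab.1 : R), ratr ab.2[%classic `<=` ball i.1 i.2.
pose J k : seq (R * R) := if @unpickle (rat * rat)%type k is Some ab then
  (if pselect (exists i, Q ab i) is left h then [:: projT1 (cid h)] else [::]) else [::].
pose s n := flatten [seq J k | k <- iota 0 n].
have JI k i : i \in J k -> I i.
  rewrite /J; case: unpickle => // ab; case: pselect => // h.
  by case: cid => j [/= Ij _]; rewrite inE => /eqP ->.
have sI n i : i \in s n -> I i by move=> /flatten_mapP[k _ /JI].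
pose F n : set RT := \big[setU/set0]_(i <- s n) ball i.1 i.2.
have mF n : measurable (F n).
  by apply: bigsetU_measurable => i _; exact: measurable_ball.
have FE : \bigcup_(i in I) ball i.1 i.2 = \bigcup_n F n :> set RT.
  apply/seteqP; split => y; last first.
    by move=> [n _]; rewrite /F -bigcup_seq => -[i /= /sI Ii yi]; exists i.
  move=> [i Ii]; rewrite ball_ltE => -[y1 y2].
  have [a] := rat_in_itvoo y1; have [b] := rat_in_itvoo y2.
  rewrite !in_itv/= => /andP[b1 b2] /andP[a1 a2].
  have h : exists i, Q (a, b) i.
    exists i; split => // z /=; rewrite in_itv/= ball_ltE => /andP[z1 z2].
    by split; [exact: lt_trans z1|exact: lt_trans b2].
  exists (pickle (a, b)).+1 => //; rewrite /F -bigcup_seq.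
  exists (projT1 (cid h)) => /=.
    apply/flatten_mapP; exists (pickle (a, b)); first by rewrite mem_iota /= add0n.
    by rewrite /J pickleK; case: pselect => // h'; rewrite (Prop_irrelevance h' h) mem_head.
  by case: cid => j [/= _ ]; apply; rewrite /= in_itv/= a2 b1.
rewrite FE; have cF := @nondecreasing_cvg_mu _ _ _ mu F mF (bigcupT_measurable _ mF).
have dF : {homo F : n m / (n <= m)%N >-> (n <= m)%O}.
  move=> n m nm; apply/subsetPset; rewrite /F -!bigcup_seq => z [i /= is_ zi].
  exists i => //=; move: is_ => /flatten_mapP[k kn ik]; apply/flatten_mapP.
  by exists k => //; move: kn; rewrite !mem_iota !add0n/= => kn; exact: leq_trans nm.
rewrite -(cvg_lim _ (cF dF))//; apply: lime_le.
  by apply/cvg_ex; eexists; exact: cF.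
apply: nearW => n; apply: cover_finite => // i /sI; [exact: IB|exact: Ile].
Qed.

Lemma decreasing_small nu (D : nat -> set RT) e : 0 < e ->
  (nu (D 0%N) < +oo)%E -> (forall n, measurable (D n)) ->
  {homo D : n m / (n <= m)%N >-> (m <= n)%O} -> (nu (\bigcap_n D n) < e%:E)%E ->
  exists n, (nu (D n) <= e%:E)%E.
Proof.
move=> e0 D0 mD dD De; apply: contrapT => h.
have he n : (e%:E <= nu (D n))%E.
  by have [//|/ltW ne] := leP e%:E (nu (D n)); exfalso; apply: h; exists n.
have cD := @nonincreasing_cvg_mu _ _ _ nu D D0 mD (bigcapT_measurable mD) dD.
move: De; rewrite ltNge => /negP; apply.
rewrite -(cvg_lim _ cD)//; apply: lime_ge; last exact: nearW.
by apply/cvg_ex; eexists; exact: cD.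
Qed.

(** * Regularity of a Borel measure inside a set of finite measure *)

Section regularity.
Variables (nu : {measure set RT -> \bar R}) (B : set RT).
Hypotheses (mB : measurable B) (nuB : (nu B < +oo)%E).

(** The error is measured inside [B] only, because [nu] is assumed finite there and continuity from
    above needs finiteness. *)
Definition squeezed : set (set RT) := [set A | forall e, 0 < e ->
  exists U F : set R, [/\ open U, closed F, F `<=` A, A `<=` U &
    (nu ((U `\` F) `&` B) <= e%:E)%E]].

Lemma nuB_lt (A : set RT) : measurable A -> (nu (A `&` B) < +oo)%E.
Proof.
by move=> mA; apply: le_lt_trans nuB; apply: le_measure; rewrite ?inE//; exact: measurableI.
Qed.

Lemma squeezed_itv x y : squeezed `]x, y[%classic.
Proof.
move=> e e0; pose d (n : nat) : R := n.+1%:R^-1.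
pose F n := `[x + d n, y - d n]%classic : set R.
pose D n : set RT := (`]x, y[%classic `\` F n) `&` B.
have mF n : measurable (F n : set RT) by exact: measurable_itv.
have FA n : F n `<=` `]x, y[%classic.
  have d0 : 0 < d n by rewrite invr_gt0.
  move=> z; rewrite /F /= !in_itv/= => /andP[z1 z2]; apply/andP; split; lra.
have [||||n nuD] := @decreasing_small nu D e e0.
- by apply: nuB_lt; apply: measurableD => //; exact: measurable_itv.
- by move=> n; apply: measurableI => //; apply: measurableD => //; exact: measurable_itv.
- move=> n m nm; apply/subsetPset; apply: setSI; apply: setDS => z.
  have : d m <= d n by rewrite lef_pV2 ?posrE// ler_nat.
  rewrite /F /= !in_itv/= => dd /andP[z1 z2]; apply/andP; split; lra.
- rewrite (_ : \bigcap_n D n = set0) ?measure0// -subset0 => z Dz.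
  have : z \in `]x, y[ by have [[]] := Dz 0%N I.
  rewrite in_itv/= => /andP[xz zy].
  have m0 : 0 < Num.min (z - x) (y - z) by rewrite lt_min !subr_gt0 xz.
  pose n := Num.truncn (Num.min (z - x) (y - z))^-1.
  have : d n < Num.min (z - x) (y - z).
    by rewrite /d -[ltRHS]invrK ltf_pV2 ?posrE ?invr_gt0// truncnS_gt.
  rewrite lt_min => /andP[d1 d2]; have [[_ nF] _] := Dz n I.
  by apply: nF; rewrite /F/= in_itv/=; apply/andP; split; lra.
exists `]x, y[%classic, (F n); split => //.
  all: try by [exact: interval_open | exact: interval_closed].
Qed.

Lemma squeezed_setC A : squeezed A -> squeezed (~` A).
Proof.
move=> sA e /sA[U [F [oU cF FA AU UF]]]; exists (~` F), (~` U); split.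
- exact: closed_openC.
- exact: open_closedC.
- exact: subsetC.
- exact: subsetC.
- by rewrite setDE setCK setIC (setIC (~` F)) -setDE setIC.
Qed.

(** The union of all the inner closed sets need not be closed, so only finitely many are kept;
    continuity from above shows that this loses little. *)
Lemma squeezed_bigcup (A : nat -> set RT) :
  (forall n, squeezed (A n)) -> squeezed (\bigcup_n A n).
Proof.
move=> sA e e0; have e20 : 0 < e / 2 by rewrite divr_gt0.
have en0 n : 0 < e / 2 / (2 ^ n.+1)%:R by rewrite divr_gt0// ltr0n expn_gt0.
have [U sU] := choice (fun n => sA n _ (en0 n)).
have [F sF] := choice sU.
have oU n : open (U n) by have [] := sF n.
have cF n : closed (F n) by have [] := sF n.
have mU n : measurable (U n : set RT) by exact: open_measurable.
have mF n : measurable (F n : set RT) by exact: closed_measurable.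
pose G n : set R := \big[setU/set0]_(k < n) F k.
have mG n : measurable (G n : set RT) by exact: bigsetU_measurable.
have GE n : G n = [set z | exists2 k, (k < n)%N & F k z].
  rewrite /G; elim: n => [|n IH].
    by rewrite big_ord0; apply/seteqP; split => // z [].
  rewrite big_ord_recr/= IH; apply/seteqP; split => z.
    by move=> [[k kn Fk]|Fn]; [exists k => //; exact: ltnW|exists n].
  move=> [k]; rewrite ltnS leq_eqVlt => /orP[/eqP ->|kn Fk]; [by right|left].
  by exists k.
pose D n : set RT := (\bigcup_n U n `\` G n) `&` B.
have mUU : measurable (\bigcup_n U n : set RT) by exact: bigcupT_measurable.
have [||||n nuD] := @decreasing_small nu D e e0.
- by apply: nuB_lt; exact: measurableD.
- by move=> n; apply: measurableI => //; exact: measurableD.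
- move=> n m nm; apply/subsetPset; apply: setSI; apply: setDS; rewrite !GE => z [k kn Fk].
  by exists k => //; exact: leq_trans nm.
- have DS : \bigcap_n D n `<=` \bigcup_n ((U n `\` F n) `&` B).
    move=> z Dz; have [[[k _ Uk] _] Bz] := Dz 0%N I; exists k => //; split => //.
    split => // Fk; have [[_ nG] _] := Dz k.+1 I; apply: nG; rewrite GE; by exists k.
  have mUF n : measurable ((U n `\` F n) `&` B : set RT).
    by apply: measurableI => //; exact: measurableD.
  (* The individual errors add up to at most [e / 2], which leaves the strict inequality that
     [decreasing_small] requires. *)
  apply: (@le_lt_trans _ _ (0 + (e / 2)%:E)%E); last first.
    by rewrite add0e lte_fin ltr_pdivrMr// ltr_pMr// ltr1n.
  have mD : measurable (\bigcap_n D n).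
    by apply: bigcapT_measurable => n; apply: measurableI => //; exact: measurableD.
  apply: le_trans (measure_sigma_subadditive nu mUF mD DS) _.
  have := @epsilon_trick R (fun=> 0%E) (e / 2) xpredT (fun=> lexx _) (ltW e20).
  rewrite [X in (_ <= X + _)%E -> _]eseries0//; apply: le_trans.
  apply: lee_nneseries => // n _; rewrite add0e; by have [] := sF n.
exists (\bigcup_n U n), (G n); split.
- by apply: bigcup_open => k _.
- by apply: closed_bigsetU => k _.
- by rewrite GE => z [k _ Fk]; exists k => //; have [_ _ /(_ z Fk)] := sF k.
- by move=> z [k _ Ak]; exists k => //; have [_ _ _ /(_ z Ak)] := sF k.
- exact: nuD.
Qed.

Lemma measurable_squeezed A : measurable A -> squeezed A.
Proof.
have -> : (measurable : set (set RT)) = (@RGenOpens.G R).-sigma.-measurable.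
  exact: RGenOpens.measurableE.
apply: smallest_sub; last by move=> _ [x [y ->]]; exact: squeezed_itv.
split; last exact: squeezed_bigcup.
- move=> e e0; exists set0, set0; split => //; try exact: open0; try exact: closed0.
  by rewrite set0D set0I measure0 lee_fin ltW.
- by move=> C sC; rewrite setTD; exact: squeezed_setC.
Qed.

End regularity.

Lemma null_set_open_cover nu (Z : set RT) x r e : radon nu ->
  measurable Z -> nu Z = 0%E -> 0 < e ->
  exists U : set R, [/\ open U, Z `&` ball x r `<=` U & (nu U <= e%:E)%E].
Proof.
move=> rnu mZ nuZ e0; have mB := measurable_ball x r.
have [U [F [oU cF FZ ZU nuUF]]] := measurable_squeezed mB (radon_ball x r rnu) mZ e0.
have mU : measurable (U : set RT) by exact: open_measurable.
have mF : measurable (F : set RT) by exact: closed_measurable.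
exists (U `&` ball x r); split.
- by apply: openI => //; exact: ball_open.
- by move=> z [/ZU Uz Bz].
have -> : U `&` ball x r = ((U `\` F) `&` ball x r) `|` (U `&` F `&` ball x r) :> set RT.
  by rewrite -setIUl setUC setUIDK.
have mUF : measurable ((U `\` F) `&` ball x r : set RT).
  by apply: measurableI => //; exact: measurableD.
have mUF' : measurable (U `&` F `&` ball x r : set RT).
  by apply: measurableI => //; exact: measurableI.
apply: le_trans (measureU2 _ mUF mUF') _.
rewrite [X in (_ + X)%E](_ : _ = 0%E) ?adde0//; apply/eqP; rewrite eq_le measure_ge0 andbT.
rewrite -nuZ; apply: le_measure; rewrite ?inE// => z [[_ /FZ]].
by [].
Qed.
End Covering.

(** * Smooth alpha-numbers as discrepancies of Lipschitz functions *)


Section Alpha.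
Context {R : realType}.
Implicit Types (x y z r p q t : R).
Notation RT := (measurableTypeR R).
Implicit Types mu nu : {measure set RT -> \bar R}.

Lemma notin_itv01 y : ~ y \in `]0, 1[ -> (y <= 0) || (1 <= y).
Proof. by rewrite in_itv/= => /negP; rewrite negb_and -!leNgt. Qed.

Lemma phiE t : phi t = Num.max 0 (Num.min t (1 - t)).
Proof.
set m := Num.max _ _.
have mlb : lbound [set `|t - y| | y in ~` [set` `]0, 1[]] m.
  move=> _ [y /= yN <-]; rewrite /m ge_max normr_ge0/= ge_min.
  have : (y <= 0) || (1 <= y).
    exact: notin_itv01.
  move=> /orP[y0|y1]; apply/orP; [left|right].
    by rewrite (le_trans _ (ler_norm _))//; lra.
  by rewrite distrC (le_trans _ (ler_norm _))//; lra.
have mS : [set `|t - y| | y in ~` [set` `]0, 1[]] m.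
  rewrite /m; have [t0|t0] := leP t 0.
    exists t; first by rewrite /= in_itv/= => /andP[]; lra.
    rewrite subrr normr0; apply/esym/max_idPl; rewrite ge_min t0//.
  have [t1|t1] := leP 1 t.
    exists t; first by rewrite /= in_itv/= => /andP[]; lra.
    by rewrite subrr normr0; apply/esym/max_idPl; rewrite ge_min subr_le0 t1 orbT.
  have [t2|t2] := leP t (1 - t).
    exists 0; first by rewrite /= in_itv/= ltxx.
    by rewrite subr0 gtr0_norm//; apply/esym/max_idPr; exact: ltW.
  exists 1; first by rewrite /= in_itv/= ltxx andbF.
  rewrite distrC gtr0_norm ?subr_gt0//; apply/esym/max_idPr; lra.
apply/le_anti/andP; split; first by apply: ge_inf => //; exists m.
by apply: lb_le_inf => //; exists m.
Qed.

Lemma T_I_ball x r y : 0 < r -> T_I (x - r) (x + r) y = ((y - x) / r + 1) / 2.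
Proof. by move=> r0; rewrite /T_I; field; rewrite gt_eqF//=; lra. Qed.

Lemma phi_hat x r y : 0 < r -> phi (T_I (x - r) (x + r) y) = 2^-1 * hat x r y.
Proof.
move=> r0; rewrite T_I_ball// phiE /hat.
have -> : `|y - x| / r = `|(y - x) / r| by rewrite normf_div (gtr0_norm r0).
set u := (y - x) / r.
case: (ger0P u) => h1; case: (leP ((u + 1) / 2)) => ?; case: leP => ?; case: leP => ?; lra.
Qed.

Lemma test_fun_eq0 (psi : R -> R) y : test_fun psi -> ~ y \in `]0, 1[ -> psi y = 0.
Proof.
move=> [lip z0] yN; apply/eqP; rewrite -normr_le0; apply/ler_addgt0Pr => e e0.
rewrite add0r; have : (y <= 0) || (1 <= y).
  exact: notin_itv01.
move=> /orP[y0|y1].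
  have := lip y (y - e); rewrite (z0 (y - e)) ?subr0.
    by rewrite opprB addrCA subrr addr0 (gtr0_norm e0).
  by rewrite in_itv/= => /andP[]; lra.
have := lip y (y + e); rewrite (z0 (y + e)) ?subr0.
  by rewrite opprD addNKr normrN (gtr0_norm e0).
by rewrite in_itv/= => /andP[]; lra.
Qed.

Lemma test_fun_le_phi (psi : R -> R) t : test_fun psi -> `|psi t| <= phi t.
Proof.
move=> tpsi; apply: lb_le_inf.
  by exists `|t - 0|; exists 0 => //=; rewrite in_itv/= ltxx.
move=> _ [y /= yN <-]; rewrite -[psi t]subr0 -(test_fun_eq0 tpsi yN); exact: tpsi.1.
Qed.

Lemma lipschitz_measurable (L : R) (f : R -> R) :
  (forall y z, `|f y - f z| <= L * `|y - z|) -> measurable_fun [set: RT] (f : RT -> R).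
Proof.
move=> lip; apply: continuous_measurable_fun => x.
apply/cvgrPdist_le => e e0; have L0 : 0 < `|L| + 1 by rewrite ltr_wpDl.
have d0 : 0 < e / (`|L| + 1) by rewrite divr_gt0.
apply: filterS (near_ball x _ d0) => y; rewrite /ball/= => xy.
apply: le_trans (lip x y) _.
apply: (@le_trans _ _ ((`|L| + 1) * `|x - y|)).
  by rewrite ler_wpM2r//; have := ler_norm L; lra.
by rewrite mulrC -ler_pdivlMr// ltW.
Qed.

Lemma Rintegral_le_ge0 mu x r c (f : R -> R) : radon mu -> 0 < r ->
  measurable_fun [set: RT] (f : RT -> R) -> (forall y, `|f y| <= c * hat x r y) ->
  `|\int[mu]_y f y| <= c * hmass mu x r.
Proof.
move=> rmu r0 mf fle; have If := integrable_dom_hat rmu r0 mf fle.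
have mN : measurable_fun [set: RT] (fun y : RT => `|f y|).
  by apply: measurableT_comp.
have fle' y : `| `|f y| | <= c * hat x r y by rewrite normr_id.
apply: le_trans (le_normr_Rintegral _ If) _ => //.
rewrite -RintegralZl//; last exact: integrable_hat.
apply: le_Rintegral => //; first exact: integrable_dom_hat fle'.
exact: (integrableZl measurableT c (integrable_hat x rmu r0)).
Qed.

Lemma test_comp_lip x r (psi : R -> R) : 0 < r -> test_fun psi ->
  forall y z, `|psi (T_I (x - r) (x + r) y) - psi (T_I (x - r) (x + r) z)| <=
    `|y - z| / (2 * r).
Proof.
move=> r0 [lip _] y z; apply: le_trans (lip _ _) _; rewrite !T_I_ball//.
rewrite (_ : _ - _ = (y - z) / (2 * r)); last by field; rewrite gt_eqF.
have r2 : 0 < 2 * r by rewrite mulr_gt0.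
by rewrite normf_div (gtr0_norm r2).
Qed.

Lemma test_comp_le x r (psi : R -> R) : 0 < r -> test_fun psi ->
  forall y, `|psi (T_I (x - r) (x + r) y)| <= 2^-1 * hat x r y.
Proof. by move=> r0 tpsi y; rewrite -phi_hat//; exact: test_fun_le_phi. Qed.

Lemma lip2r_measurable r (f : R -> R) : 0 < r ->
  (forall y z, `|f y - f z| <= `|y - z| / (2 * r)) ->
  measurable_fun [set: RT] (f : RT -> R).
Proof.
by move=> r0 lip; apply: (@lipschitz_measurable (2 * r)^-1) => y z; rewrite mulrC.
Qed.

(** The restriction to the interval disappears because the test function vanishes off the ball, and
    the factor [2] comes from [phi] being half a hat. *)
Lemma int_normE mu x r (psi : R -> R) : radon mu -> 0 < r -> test_fun psi ->
  int_norm mu (x - r) (x + r) psi =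
  (2 * (\int[mu]_y psi (T_I (x - r) (x + r) y)) / hmass mu x r)%:E.
Proof.
move=> rmu r0 tpsi; rewrite /int_norm.
have -> : (\int[mu]_y (phi (T_I (x - r)%R (x + r)%R y))%:E = (2^-1 * hmass mu x r)%:E)%E.
  under eq_integral do rewrite phi_hat//.
  rewrite EFinM EFin_hmass// -ge0_integralZl//.
  - by apply/measurable_EFinP; exact: measurable_hat.
  - by move=> y _; rewrite lee_fin hat_ge0.
(* With the convention that [0] has inverse [0], the quotient formula also covers a vanishing
   denominator. *)
case: eqP => [[/eqP]|_].
  by rewrite mulf_eq0 invr_eq0 pnatr_eq0/= => /eqP ->; rewrite invr0 mulr0.
have If := integrable_dom_hat rmu r0 (lip2r_measurable r0 (test_comp_lip x r0 tpsi))
  (test_comp_le x r0 tpsi).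
have -> : (\int[mu]_(y in `](x - r)%R, (x + r)%R[) (psi (T_I (x - r)%R (x + r)%R y))%:E =
    (\int[mu]_y psi (T_I (x - r) (x + r) y))%R%:E)%E.
  rewrite /Rintegral fineK; last exact: (integrable_fin_num measurableT If).
  rewrite [LHS]integral_mkcond; apply: eq_integral => y _; rewrite patchE.
  case: ifPn => // /negP yN; congr EFin; apply/esym/eqP; rewrite -normr_le0.
  apply: le_trans (test_comp_le x r0 tpsi y) _; rewrite hat_eq0 ?mulr0//.
  rewrite leNgt; apply/negP => yx; apply: yN; rewrite -ball_itv inE /ball/=.
  by rewrite distrC.
by rewrite /= -EFinM; congr EFin; rewrite invfM invrK; ring.
Qed.

Definition discr mu nu x r (f : R -> R) : R :=
  `|2 * (\int[mu]_y f y) / hmass mu x r - 2 * (\int[nu]_y f y) / hmass nu x r|.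

Lemma alpha_s_ub mu nu x r b : radon mu -> radon nu -> 0 < r ->
  (forall f, (forall y z, `|f y - f z| <= `|y - z| / (2 * r)) ->
    (forall y, `|f y| <= 2^-1 * hat x r y) -> discr mu nu x r f <= b) ->
  (alpha_s mu nu (x - r) (x + r) <= b%:E)%E.
Proof.
move=> rmu rnu r0 h; apply: ge_ereal_sup => _ [psi tpsi <-].
rewrite !int_normE// -EFinB lee_fin; apply: h.
  exact: test_comp_lip.
exact: test_comp_le.
Qed.

(** [T_I] is inverted explicitly to turn [f] into a test function; the slope [1 / (2 * r)] becomes
    [1] because the ball has length [2 * r]. *)
Lemma alpha_s_lb mu nu x r (f : R -> R) : radon mu -> radon nu -> 0 < r ->
  (forall y z, `|f y - f z| <= `|y - z| / (2 * r)) ->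
  (forall y, ~ ball x r y -> f y = 0) ->
  ((discr mu nu x r f)%:E <= alpha_s mu nu (x - r) (x + r))%E.
Proof.
move=> rmu rnu r0 lip z0; pose psi t := f (x + r * (2 * t - 1)).
have psiE y : psi (T_I (x - r) (x + r) y) = f y.
  by rewrite /psi T_I_ball//; congr f; field; rewrite gt_eqF.
have tpsi : test_fun psi.
  split=> [s t|t tN].
    apply: le_trans (lip _ _) _.
    have r2 : 0 < 2 * r by rewrite mulr_gt0.
    have -> : x + r * (2 * s - 1) - (x + r * (2 * t - 1)) = (s - t) * (2 * r) by ring.
    by rewrite normrM (gtr0_norm r2) mulfK ?gt_eqF.
  apply: z0 => bt; have : ball x r (x + r * (2 * t - 1)) := bt.
  rewrite (@ball_ltE R) => -[h1 h2]; apply: tN; rewrite in_itv/=.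
  have h3 : 0 < r * (2 * t) by lra.
  have h4 : 0 < r * (2 - 2 * t) by lra.
  by rewrite !pmulr_rgt0// in h3 h4; apply/andP; split; lra.
apply: ereal_sup_ubound; exists psi => //; rewrite !int_normE// -EFinB /discr.
congr (`|_|%:E); rewrite /Rintegral; congr (_ - _).
all: congr (_ * _ / _); congr fine; apply: eq_integral => y _; by rewrite psiE.
Qed.

Lemma alpha_s_ge0 mu nu x r : radon mu -> radon nu -> 0 < r ->
  (0 <= alpha_s mu nu (x - r) (x + r))%E.
Proof.
move=> rmu rnu r0; apply: le_trans _ (@alpha_s_lb mu nu x r (fun=> 0) rmu rnu r0 _ _).
- by rewrite lee_fin normr_ge0.
- by move=> y z; rewrite subrr normr0 divr_ge0// mulr_ge0// ltW.
- by [].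
Qed.

(** Admissible functions are dominated by half the hat, so each of the two normalised integrals is
    at most [1] in absolute value. *)
Lemma alpha_s_le2 mu nu x r : radon mu -> radon nu -> 0 < r ->
  (alpha_s mu nu (x - r) (x + r) <= 2%:E)%E.
Proof.
move=> rmu rnu r0; apply: alpha_s_ub => // f lip fle.
have H m : radon m -> `|2 * (\int[m]_y f y) / hmass m x r| <= 1.
  move=> rm; have Jle := Rintegral_le_ge0 rm r0 (lip2r_measurable r0 lip) fle.
  have [->|m0] := eqVneq (hmass m x r) 0; first by rewrite invr0 mulr0 normr0.
  have m1 : 0 < hmass m x r by rewrite lt_neqAle eq_sym m0 hmass_ge0.
  rewrite normf_div (gtr0_norm m1) ler_pdivrMr// normrM (@gtr0_norm _ 2)//; lra.
by apply: le_trans (ler_normB _ _) _; rewrite -[2]/(1 + 1) lerD ?H.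
Qed.

End Alpha.

(** * Dyadic bounds for the square function, and doubling *)


Section SquareFunction.
Context {R : realType}.
Implicit Types (x y z r p q t : R).
Notation RT := (measurableTypeR R).
Implicit Types mu nu : {measure set RT -> \bar R}.

Lemma le_integral_ge0 d (T : measurableType d) (m : {measure set T -> \bar R})
    (D : set T) (f g : T -> \bar R) :
  (forall w : T, D w -> 0 <= f w)%E -> (forall w : T, D w -> f w <= g w)%E ->
  (\int[m]_(w in D) f w <= \int[m]_(w in D) g w)%E.
Proof.
move=> f0 fg; have g0 (w : T) : D w -> (0 <= g w)%E.
  by move=> Dw; exact: le_trans (f0 w Dw) (fg w Dw).
rewrite !ge0_integralE//; apply: ereal_sup_le => _ [h /= hf <-]; exists h => //= w.
apply: le_trans (hf w) _; rewrite /patch; case: ifPn => // /set_mem; exact: fg.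
Qed.

Definition tile n : set R := `[2^-1 ^+ n.+1, 2^-1 ^+ n[%classic.

Lemma tileE n r : tile n r <-> 2^-1 ^+ n.+1 <= r < 2^-1 ^+ n.
Proof. by rewrite /tile/= in_itv. Qed.

Lemma measurable_tile n : measurable (tile n : set RT).
Proof. exact: measurable_itv. Qed.

Lemma half_lt1 n : 0 < 2^-1 ^+ n :> R.
Proof. by rewrite exprn_gt0// invr_gt0. Qed.

Lemma measure_tile n : lebesgue_measure (tile n) = (2^-1 ^+ n.+1)%:E.
Proof.
rewrite /tile lebesgue_measure_itv/= lte_fin.
rewrite exprS gtr_pMl ?half_lt1// invf_lt1// ltr1n -EFinB; congr EFin; lra.
Qed.

Lemma half_mono (n m : nat) : (n <= m)%N -> 2^-1 ^+ m <= 2^-1 ^+ n :> R.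
Proof. by move=> nm; rewrite ler_wiXn2l// ?invr_ge0// invf_le1// ler1n. Qed.

Lemma tile_sub01 n r : tile n r -> 0 < r < 1.
Proof.
move=> /tileE /andP[h1 h2]; rewrite (lt_le_trans (half_lt1 _) h1)/=.
by apply: lt_le_trans h2 _; have := half_mono (leq0n n); rewrite expr0.
Qed.

Lemma tile_uniq n m r : tile n r -> tile m r -> n = m.
Proof.
move=> /tileE /andP[n1 n2] /tileE /andP[m1 m2]; apply/eqP; rewrite eqn_leq.
apply/andP; split; rewrite leqNgt; apply/negP => /half_mono h; lra.
Qed.

Lemma tile_exists r : 0 < r < 1 -> exists n, tile n r.
Proof.
move=> /andP[r0 r1]; have ex : exists n, 2^-1 ^+ n <= r.
  exists (Num.truncn r^-1).+1; rewrite exprVn -[leRHS]invrK lef_pV2 ?posrE ?invr_gt0//.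
  apply: ltW; apply: lt_trans (truncnS_gt _) _.
  by rewrite -natrX ltr_nat ltn_expl.
case: (ex_minnP ex) => -[|n] nr nmin; first by rewrite expr0 in nr; lra.
exists n; apply/tileE; rewrite nr/= ltNge; apply/negP => /nmin; by rewrite ltnn.
Qed.

(** On [tile n] the factor [1 / r] lies between [2 ^ n] and [2 ^ n.+1], so [u n / r] lies between
    this step function and its double, whose integrals are [u n / 2] and [u n]. *)
Definition weight (u : nat -> R) n r : R := u n * 2 ^+ n * \1_(tile n) r.

Lemma sq_fun_ge mu nu x K (u : nat -> R) : radon mu -> radon nu ->
  (forall n, 0 <= u n) ->
  (forall n r, (n < K)%N -> tile n r ->
    (u n)%:E <= alpha_s mu nu (x - r) (x + r) * alpha_s mu nu (x - r) (x + r))%E ->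
  ((2^-1 * \sum_(n < K) u n)%:E <= sq_fun mu nu x)%E.
Proof.
move=> rmu rnu u0 ua; pose g r := \sum_(n < K) (weight u n r)%:E.
have w0 n r : (0 <= (weight u n r)%:E)%E by rewrite lee_fin mulr_ge0// mulr_ge0// exprn_ge0.
have mw n : measurable_fun (`]0, 1[%classic : set RT) (EFin \o weight u n).
  apply/measurable_EFinP; apply: measurable_funTS; apply: measurable_funM => //.
  by apply: measurable_indic; exact: measurable_tile.
have wint n : (\int[lebesgue_measure]_(r in `]0%R, 1%R[) (weight u n r)%:E =
    (2^-1 * u n)%:E)%E.
  rewrite /weight; under eq_integral do rewrite EFinM.
  rewrite ge0_integralZl//; first last.
  - by rewrite lee_fin mulr_ge0// exprn_ge0.
  - by apply/measurable_EFinP; apply: measurable_indic; exact: measurable_tile.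
  rewrite integral_indic//; last exact: measurable_tile.
  rewrite setIidl; last by move=> r /tile_sub01; rewrite /= in_itv.
  rewrite [X in (_ * X)%E]measure_tile -EFinM; congr EFin.
  rewrite exprVn exprS; field; by rewrite expf_neq0 ?pnatr_eq0.
have -> : (2^-1 * \sum_(n < K) u n)%:E =
    (\int[lebesgue_measure]_(r in `]0%R, 1%R[) g r)%E.
  rewrite /g ge0_integral_sum//; last by move=> n; exact: mw.
  by rewrite mulr_sumr -sumEFin; apply: eq_bigr => n _; rewrite wint.
apply: le_integral_ge0 => r; rewrite /= in_itv/= => r01.
  by apply: sume_ge0 => n _.
have r0 : 0 < r by have /andP[] := r01.
have a0 := alpha_s_ge0 x rmu rnu r0.
have [n nr] := tile_exists r01; rewrite /g sumEFin.
have other m : m != n -> weight u m r = 0.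
  move=> mn; rewrite /weight indicE memNset ?mulr0// => mr.
  by move: mn; rewrite (tile_uniq mr nr) eqxx.
have [nK|Kn] := ltnP n K; last first.
  rewrite big1 ?mule_ge0 ?lee_fin ?invr_ge0 ?(ltW r0)// => m _; apply: other.
  by rewrite neq_ltn (leq_trans (ltn_ord m)).
rewrite (bigD1 (Ordinal nK))//= big1 ?addr0; last first.
  by move=> m; rewrite -val_eqE/=; exact: other.
rewrite /weight indicE mem_set// mulr1 EFinM lee_pmul ?lee_fin ?u0 ?exprn_ge0//.
  exact: ua.
move: nr => /tileE/andP[_ /ltW]; rewrite exprVn => rn.
by rewrite -[leLHS]invrK lef_pV2// posrE// invr_gt0 exprn_gt0.
Qed.

Lemma sq_fun_le mu nu x (u : nat -> R) : radon mu -> radon nu ->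
  (forall n, 0 <= u n) ->
  (forall n r, tile n r ->
    alpha_s mu nu (x - r) (x + r) * alpha_s mu nu (x - r) (x + r) <= (u n)%:E)%E ->
  (sq_fun mu nu x <= \sum_(0 <= n <oo) (u n)%:E)%E.
Proof.
move=> rmu rnu u0 ua.
have w0 n r : (0 <= (2 * weight u n r)%:E)%E.
  by rewrite lee_fin !mulr_ge0// exprn_ge0.
have mw n : measurable_fun (`]0, 1[%classic : set RT) (fun r => (2 * weight u n r)%:E).
  apply/measurable_EFinP; apply: measurable_funM => //; apply: measurable_funTS.
  apply: measurable_funM => //.
  by apply: measurable_indic; exact: measurable_tile.
apply: (@le_trans _ _ (\int[lebesgue_measure]_(r in `]0%R, 1%R[)
    \sum_(0 <= n <oo) (2 * weight u n r)%R%:E)%E).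
  apply: le_integral_ge0 => r; rewrite /= in_itv/= => r01.
    have r0 : 0 < r by have /andP[] := r01.
    have a0 := alpha_s_ge0 x rmu rnu r0.
    by rewrite mule_ge0 ?lee_fin ?invr_ge0 ?(ltW r0)// mule_ge0.
  have r0 : 0 < r by have /andP[] := r01.
  have a0 := alpha_s_ge0 x rmu rnu r0.
  have [n nr] := tile_exists r01.
  apply: (@le_trans _ _ (2 * weight u n r)%:E); last first.
    have := @nneseries_lim_ge R (fun n => (2 * weight u n r)%:E) xpredT 0 n.+1 (fun n _ _ => w0 n r).
    apply: le_trans; rewrite big_nat_recr//= leeDr// sume_ge0// => k _; exact: w0.
  rewrite /weight indicE mem_set// mulr1 mulrCA EFinM lee_pmul ?mule_ge0 ?lee_fin ?invr_ge0 ?(ltW r0)//.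
    exact: ua.
  move: nr => /tileE/andP[]; rewrite exprVn => rn _.
  by rewrite -exprS -[leRHS]invrK lef_pV2// posrE// invr_gt0 exprn_gt0.
rewrite integral_nneseries//; apply: lee_nneseries => n _.
  by move=> _; apply: integral_ge0.
rewrite /weight; under eq_integral do rewrite mulrA EFinM.
rewrite ge0_integralZl//; first last.
- by rewrite lee_fin !mulr_ge0// exprn_ge0.
- by apply/measurable_EFinP; apply: measurable_indic; exact: measurable_tile.
rewrite integral_indic//; last exact: measurable_tile.
rewrite setIidl; last by move=> r /tile_sub01; rewrite /= in_itv.
rewrite [X in (_ * X)%E]measure_tile -EFinM.
rewrite lee_fin exprVn exprS (_ : _ / _ = u n)//.
by field; rewrite expf_neq0 ?pnatr_eq0.
Qed.

Section doubling.
Variables (nu : {measure set RT -> \bar R}).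
Hypotheses (rnu : radon nu) (dnu : doubling nu).

Lemma doubling_iter : exists2 C : R, 1 <= C & forall x r k, 0 < r ->
  (nu (ball x (2 ^+ k * r)) <= (C ^+ k)%:E * nu (ball x r))%E.
Proof.
(* The doubling constant may a priori be less than [1] or negative; the maximum makes its powers
   usable as factors. *)
have [C hC] := dnu; exists (Num.max C 1); first by rewrite le_max lexx orbT.
move=> x r k r0; elim: k => [|k IH]; first by rewrite !expr0 mul1e mul1r.
rewrite exprS -mulrA; apply: le_trans (hC _ _ _) _; first by rewrite mulr_gt0// exprn_gt0.
apply: (@le_trans _ _ ((Num.max C 1)%:E * nu (ball x (2 ^+ k * r)))%E).
  by apply: lee_wpmul2r => //; rewrite lee_fin le_max lexx.
rewrite exprS EFinM -muleA; apply: lee_wpmul2l => //.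
by rewrite lee_fin le_max ler01 orbT.
Qed.

Definition comparable_hats (k : R) := forall x r x' r', 0 < r -> 0 < r' ->
  `|x - x'| <= 16 * r' -> r <= 16 * r' -> hmass nu x r <= k * hmass nu x' r'.

Lemma doubling_hmass : exists2 k : R, 1 <= k & comparable_hats k.
Proof.
have [C C1 hC] := doubling_iter; exists (2 * C ^+ 6).
  by have := exprn_ege1 6 C1; lra.
move=> x r x' r' r0 r'0 xx rr; rewrite -lee_fin.
apply: le_trans (hmass_le_ball x rnu r0) _.
(* The first ball lies in the ball of radius [32 * r'] about [x'], that is [2 ^ 6] times the radius
   [r' / 2] on which the second hat is at least [1/2]. *)
apply: (@le_trans _ _ (nu (ball x' (2 ^+ 6 * (r' / 2))))).
  apply: le_measure; rewrite ?inE; try exact: measurable_ball.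
  have := ler_norm (x - x'); have := ler_norm (x' - x); rewrite (distrC x') => h1 h2.
  have E : 2 ^+ 6 * (r' / 2) = 32 * r' by field.
  by move=> z; rewrite E !ball_ltE => -[h3 h4]; split; lra.
apply: le_trans (hC _ _ _ _) _; first by rewrite divr_gt0.
rewrite (_ : 2 * C ^+ 6 * _ = C ^+ 6 * (2 * hmass nu x' r')); last by ring.
rewrite [leRHS]EFinM; apply: lee_wpmul2l; last exact: ball_le_hmass.
by rewrite lee_fin exprn_ge0//; lra.
Qed.

Lemma hmass_eq0_null x r : 0 < r -> hmass nu x r = 0 -> nu setT = 0%E.
Proof.
move=> r0 h0; have [C C1 hC] := doubling_iter.
have r20 : 0 < r / 2 by rewrite divr_gt0.
have nb : nu (ball x (r / 2)) = 0%E.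
  apply/eqP; rewrite eq_le measure_ge0 andbT.
  by apply: le_trans (ball_le_hmass x rnu r0) _; rewrite h0 mulr0.
have -> : setT = \bigcup_n ball x (2 ^+ n * (r / 2)) :> set RT.
  apply/seteqP; split => // y _; exists (Num.truncn (`|x - y| / (r / 2))).+1 => //.
  rewrite /ball/= -ltr_pdivrMr//; apply: lt_trans (truncnS_gt _) _.
  by rewrite -natrX ltr_nat ltn_expl.
apply/eqP; rewrite eq_le measure_ge0 andbT.
have mb n : measurable (ball x (2 ^+ n * (r / 2)) : set RT) by exact: measurable_ball.
apply: le_trans (generalized_Boole_inequality nu mb _) _.
  exact: bigcupT_measurable.
rewrite eseries0// => n _ _; apply/eqP; rewrite eq_le measure_ge0 andbT.
by apply: le_trans (hC _ _ _ r20) _; rewrite nb mule0.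
Qed.

End doubling.
End SquareFunction.

(** * Densities along the tree *)


Section Refine.
Context {R : realType}.
Implicit Types (x y z r p q t : R) (X Y : R -> R -> R).
Notation RT := (measurableTypeR R).
Implicit Types mu nu : {measure set RT -> \bar R}.

Definition child x r p := [\/ p = x - r / 2, p = x | p = x + r / 2].

Lemma refine_le X Y x r : (forall p, child x r p -> X p (r / 2) <= Y p (r / 2)) ->
  refine X x r <= refine Y x r.
Proof.
move=> h; rewrite /refine; have h1 := h (x - r / 2) (Or31 _ _ erefl).
have h2 := h x (Or32 _ _ erefl); have h3 := h (x + r / 2) (Or33 _ _ erefl).
by rewrite !lerD// ler_wpM2l ?invr_ge0.
Qed.

Lemma eq_refine X Y x r : (forall p, child x r p -> X p (r / 2) = Y p (r / 2)) ->
  refine X x r = refine Y x r.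
Proof. by move=> h; apply/le_anti/andP; split; apply: refine_le => p /h ->. Qed.

Lemma refineD X Y x r :
  refine (fun p q => X p q + Y p q) x r = refine X x r + refine Y x r.
Proof. rewrite /refine; lra. Qed.

Lemma refineZ c X x r : refine (fun p q => c * X p q) x r = c * refine X x r.
Proof. rewrite /refine; lra. Qed.

Lemma refine_ge0 X x r : (forall p, 0 <= X p (r / 2)) -> 0 <= refine X x r.
Proof. by move=> h; rewrite /refine !addr_ge0// mulr_ge0// invr_ge0. Qed.

Lemma refine_norm X x r : `|refine X x r| <= refine (fun p q => `|X p q|) x r.
Proof.
rewrite /refine; apply: le_trans (ler_normD _ _) _; rewrite lerD//.
  by apply: le_trans (ler_normD _ _) _; rewrite lerD// normrM gtr0_norm// invr_gt0.
by rewrite normrM gtr0_norm// invr_gt0.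
Qed.

Lemma hmass_child mu x r p : radon mu -> 0 < r -> child x r p ->
  hmass mu p (r / 2) <= 2 * hmass mu x r.
Proof.
move=> rmu r0; rewrite -(hmass_refine x rmu r0) /refine.
have h1 := hmass_ge0 mu (x - r / 2) (r / 2); have h2 := hmass_ge0 mu x (r / 2).
have h3 := hmass_ge0 mu (x + r / 2) (r / 2).
by case=> ->; lra.
Qed.

Lemma child_dist x r p : 0 < r -> child x r p -> `|p - x| <= r / 2.
Proof.
move=> r0; have r2 : 0 <= r / 2 by rewrite divr_ge0// ltW.
case=> ->; first by rewrite addrAC subrr add0r normrN ger0_norm.
  by rewrite subrr normr0.
by rewrite addrAC subrr add0r ger0_norm.
Qed.

Lemma hat_child x r p y : 0 < r -> child x r p -> r <= `|y - x| -> hat p (r / 2) y = 0.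
Proof.
move=> r0 cp ry; apply: hat_eq0; first by rewrite divr_gt0.
have := ler_distD p y x; have := child_dist r0 cp; lra.
Qed.

Variables (mu nu : {measure set RT -> \bar R}) (k : R).
Hypotheses (rmu : radon mu) (rnu : radon nu) (k1 : 1 <= k).
Hypothesis hk : comparable_hats nu k.
Hypothesis nu_gt0 : forall x r, 0 < r -> 0 < hmass nu x r.

Local Notation M := (hmass mu).
Local Notation N := (hmass nu).

Definition dens x r : R := M x r / N x r.

Lemma dens_ge0 x r : 0 <= dens x r.
Proof. by rewrite /dens divr_ge0// hmass_ge0. Qed.

Lemma densE x r : 0 < r -> M x r = N x r * dens x r.
Proof. by move=> r0; rewrite /dens mulrC divfK// gt_eqF// nu_gt0. Qed.

Lemma hmass_parent_le x r p : 0 < r -> child x r p -> N x r <= k * N p (r / 2).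
Proof.
move=> r0 cp; apply: hk => //; rewrite ?divr_gt0//; last lra.
by have := child_dist r0 cp; rewrite distrC; lra.
Qed.

(** Bounds the growth of [M * ln (1 + dens)] over one generation. *)
Definition entropy_defect x r : R :=
  refine (fun p q => N p q * (dens p q - dens x r) ^+ 2) x r / (1 + dens x r).

(** The exact loss of the concave potential [N * dens / (1 + dens)] over one generation. *)
Definition energy x r : R :=
  refine (fun p q => N p q * (dens p q - dens x r) ^+ 2 / (1 + dens p q)) x r /
  (1 + dens x r) ^+ 2.

Definition osc x r : R := refine (fun p q => N p q * `|dens p q - dens x r|) x r.

Lemma entropy_defect_ge0 x r : 0 <= entropy_defect x r.
Proof.
apply: divr_ge0; last by rewrite addr_ge0 ?dens_ge0.
apply: refine_ge0 => p; by rewrite mulr_ge0 ?hmass_ge0 ?sqr_ge0.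
Qed.

Lemma energy_ge0 x r : 0 <= energy x r.
Proof.
apply: divr_ge0; last by rewrite exprn_ge0 ?addr_ge0 ?dens_ge0.
apply: refine_ge0 => p; apply: divr_ge0.
  by rewrite mulr_ge0 ?hmass_ge0 ?sqr_ge0.
by rewrite addr_ge0 ?dens_ge0.
Qed.

Lemma osc_ge0 x r : 0 <= osc x r.
Proof. by apply: refine_ge0 => p; rewrite mulr_ge0 ?hmass_ge0. Qed.

(** The martingale property: the parent's density is the [N]-weighted average of its children's,
    because both masses satisfy the refinement equation. *)
Lemma refine_dev x r : 0 < r ->
  refine (fun p q => N p q * (dens p q - dens x r)) x r = 0.
Proof.
move=> r0; transitivity (refine (fun p q => M p q + - dens x r * N p q) x r).
  apply: eq_refine => p _; rewrite densE ?divr_gt0//; ring.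
by rewrite refineD refineZ !hmass_refine// densE//; ring.
Qed.

(** The tangent line of [ln] at [1 + D] bounds each child's logarithm. After multiplication by
    [M' = N' * D'], writing [D' * (D' - D) = (D' - D) ^ 2 + D * (D' - D)] leaves the defect and a
    linear term that cancels by [refine_dev]. *)
Lemma refine_entropy x r : 0 < r ->
  refine (fun p q => M p q * ln (1 + dens p q)) x r <=
  M x r * ln (1 + dens x r) + entropy_defect x r.
Proof.
move=> r0; set D := dens x r; have D0 : 0 <= D by exact: dens_ge0.
have D1 : 0 < 1 + D by rewrite ltr_wpDr.
apply: (@le_trans _ _ (refine (fun p q => ln (1 + D) * M p q +
   ((1 + D)^-1 * (N p q * (dens p q - D) ^+ 2) +
    D / (1 + D) * (N p q * (dens p q - D)))) x r)).
  apply: refine_le => p _; have r20 : 0 < r / 2 by rewrite divr_gt0.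
  set D' := dens p (r / 2); have D'0 : 0 <= D' by exact: dens_ge0.
  have E : ln (1 + D') <= ln (1 + D) + (D' - D) / (1 + D).
    rewrite -lerBlDl -ln_div ?posrE//; last by rewrite ltr_wpDr.
    rewrite (_ : (1 + D') / (1 + D) = 1 + (D' - D) / (1 + D)); last first.
      by field; rewrite gt_eqF.
    by apply: le_ln1Dx; rewrite ltr_pdivlMr//; lra.
  apply: le_trans (ler_wpM2l (hmass_ge0 mu p (r / 2)) E) _.
  rewrite le_eqVlt; apply/orP; left; apply/eqP; rewrite (densE p r20) -/D'.
  by field; rewrite gt_eqF.
rewrite 2!refineD !refineZ refine_dev// mulr0 addr0 hmass_refine// mulrC.
by rewrite (mulrC (1 + D)^-1).
Qed.

(** The second-order expansion of [D' / (1 + D')] at [D] has the exact remainder [- (D' - D) ^ 2 /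
    ((1 + D) ^ 2 * (1 + D'))], and the linear term cancels by [refine_dev]. *)
Lemma refine_energy x r : 0 < r ->
  refine (fun p q => N p q * (dens p q / (1 + dens p q))) x r =
  N x r * (dens x r / (1 + dens x r)) - energy x r.
Proof.
move=> r0; set D := dens x r; have D0 : 0 <= D by exact: dens_ge0.
have D1 : 0 < 1 + D by rewrite ltr_wpDr.
transitivity (refine (fun p q => (D / (1 + D)) * N p q +
   ((1 + D) ^- 2 * (N p q * (dens p q - D)) +
    - (1 + D) ^- 2 * (N p q * (dens p q - D) ^+ 2 / (1 + dens p q)))) x r).
  apply: eq_refine => p _; set D' := dens p (r / 2).
  have D'0 : 0 <= D' by exact: dens_ge0.
  by field; rewrite !gt_eqF// ltr_wpDr.
rewrite 2!refineD !refineZ refine_dev// mulr0 add0r hmass_refine// mulrC /energy -/D.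
by rewrite mulNr (mulrC ((1 + D) ^- 2)).
Qed.

(** The potential [W] telescopes along the generations and lies between [0] and [N]. *)
Lemma sum_energy K x r : 0 < r -> \sum_(n < K) tree n energy x r <= N x r.
Proof.
move=> r0; pose W p q := N p q * (dens p q / (1 + dens p q)).
have W0 p q : 0 <= W p q by rewrite mulr_ge0 ?hmass_ge0// divr_ge0 ?addr_ge0 ?dens_ge0.
have WN : W x r <= N x r.
  by rewrite ler_piMr ?hmass_ge0// ler_pdivrMr ?mul1r ?lerDr// ltr_wpDr ?dens_ge0.
suff -> : \sum_(n < K) tree n energy x r = W x r - tree K W x r.
  by apply: le_trans WN; rewrite lerBlDr lerDl; apply: tree_ge0.
elim: K => [|K IH]; first by rewrite big_ord0 subrr.
rewrite big_ord_recr/= IH -treeS treeSr.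
have -> : tree K (refine W) x r = tree K (fun p q => W p q + -1 * energy p q) x r.
  apply: eq_tree => p; rewrite refine_energy ?mulN1r//.
  by rewrite divr_gt0// exprn_gt0.
rewrite treeDl treeZ; ring.
Qed.

Lemma osc_le x r : 0 < r -> osc x r <= 2 * M x r.
Proof.
move=> r0; apply: (@le_trans _ _ (refine (fun p q => M p q + dens x r * N p q) x r)).
  apply: refine_le => p _; rewrite (densE p) ?divr_gt0// (mulrC (dens x r)) -mulrDr.
  rewrite ler_wpM2l ?hmass_ge0//; apply: le_trans (ler_normB _ _) _.
  by rewrite !ger0_norm ?dens_ge0.
by rewrite refineD refineZ !hmass_refine// (densE x r0); lra.
Qed.

Lemma dens_child x r p : 0 < r -> child x r p -> dens p (r / 2) <= 2 * k * dens x r.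
Proof.
move=> r0 cp; have r20 : 0 < r / 2 by rewrite divr_gt0.
rewrite {1}/dens ler_pdivrMr ?nu_gt0//; apply: le_trans (hmass_child rmu r0 cp) _.
rewrite (densE x r0) (_ : 2 * k * dens x r * _ = 2 * (k * N p (r / 2) * dens x r));
  last by ring.
rewrite ler_pM2l// ler_wpM2r ?dens_ge0//; exact: hmass_parent_le.
Qed.

(** Termwise the inequality [a <= t / 2 + a ^ 2 / (2 * t)]. The constant undoes the denominators of
    [energy], with [dens_child] bounding the children's densities. Leaving [t] free amounts to
    Cauchy-Schwarz once it is optimised. *)
Lemma osc_energy x r lam t : 0 < r -> 0 < t -> dens x r <= lam ->
  osc x r <= t / 2 * N x r +
    ((1 + lam) ^+ 2 * (1 + 2 * k * lam)) / (2 * t) * energy x r.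
Proof.
move=> r0 t0 Dl; set D := dens x r; have D0 : 0 <= D by exact: dens_ge0.
have l0 : 0 <= lam by exact: le_trans Dl.
have k0 : 0 <= k by apply: le_trans k1.
pose C := (1 + lam) ^+ 2 * (1 + 2 * k * lam) / (2 * t) / (1 + D) ^+ 2.
apply: (@le_trans _ _ (refine (fun p q => t / 2 * N p q +
   C * (N p q * (dens p q - D) ^+ 2 / (1 + dens p q))) x r)); last first.
  rewrite refineD !refineZ hmass_refine// lerD2l /energy -/D /C.
  by rewrite -!mulrA; rewrite (mulrC (refine _ _ _)).
apply: refine_le => p cp; set D' := dens p (r / 2); set n := hmass nu _ _.
have D'0 : 0 <= D' by exact: dens_ge0.
have n0 : 0 <= n by exact: hmass_ge0.
have -> : t / 2 * n + C * (n * (D' - D) ^+ 2 / (1 + D')) =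
    n * (t / 2 + C / (1 + D') * `|D' - D| ^+ 2) by rewrite -normrX ger0_norm ?sqr_ge0//; ring.
rewrite ler_wpM2l//; set a := `|D' - D|.
have Ct : (2 * t)^-1 <= C / (1 + D').
  have -> : C / (1 + D') = (1 + lam) ^+ 2 * (1 + 2 * k * lam) / (1 + D') / (1 + D) ^+ 2 *
      (2 * t)^-1 by rewrite /C; field; rewrite !gt_eqF// ?ltr_wpDr.
  rewrite ler_peMl ?invr_ge0 ?mulr_ge0 ?(ltW t0)//.
  rewrite ler_pdivlMr ?exprn_gt0 ?ltr_wpDr// mul1r.
  rewrite ler_pdivlMr ?ltr_wpDr//.
  have h2 : 1 + D' <= 1 + 2 * k * lam.
    rewrite lerD2l; apply: le_trans (dens_child r0 cp) _.
    by rewrite ler_wpM2l// mulr_ge0.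
  apply: ler_pM => //; [by rewrite exprn_ge0 ?addr_ge0|by rewrite addr_ge0|].
  by rewrite lerXn2r ?nnegrE ?addr_ge0// lerD2l.
apply: (@le_trans _ _ (t / 2 + (2 * t)^-1 * a ^+ 2)); last first.
  by rewrite lerD2l; apply: ler_wpM2r => //; exact: sqr_ge0.
rewrite -subr_ge0.
have -> : t / 2 + (2 * t)^-1 * a ^+ 2 - a = (2 * t)^-1 * (t - a) ^+ 2.
  by field; rewrite gt_eqF.
by rewrite mulr_ge0 ?sqr_ge0// invr_ge0 mulr_ge0// ltW.
Qed.

End Refine.

(** * The singular part *)


Section SingularPart.
Context {R : realType}.
Implicit Types (x y z r p q t e : R) (X Y : R -> R -> R).
Notation RT := (measurableTypeR R).

Lemma last_lt (P : nat -> Prop) K : (forall n, (n < K)%N -> ~ P n) \/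
  exists m, [/\ (m < K)%N, P m & forall n, (n < K)%N -> P n -> (n <= m)%N].
Proof.
elim: K => [|K IH]; first by left.
have [PK|NPK] := pselect (P K); first by right; exists K; split.
case: IH => [h|[m [mK Pm mmax]]]; [left|right].
  by move=> n; rewrite ltnS leq_eqVlt => /orP[/eqP ->//|/h].
exists m; split => //; first exact: ltnW.
by move=> n; rewrite ltnS leq_eqVlt => /orP[/eqP ->//|/mmax].
Qed.

Lemma measure_liminf_le (mu : {measure set RT -> \bar R}) (F : nat -> set RT) b :
  (forall n, measurable (F n)) -> (forall n, mu (F n) <= b)%E ->
  measurable (\bigcup_m \bigcap_(n in [set n | (m <= n)%N]) F n) /\
  (mu (\bigcup_m \bigcap_(n in [set n | (m <= n)%N]) F n) <= b)%E.
Proof.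
move=> mF Fb; pose G m : set RT := \bigcap_(n in [set n | (m <= n)%N]) F n.
have mG m : measurable (G m) by apply: bigcap_measurable => //; exists m => /=.
have mU : measurable (\bigcup_m G m) by exact: bigcupT_measurable.
split => //; have ndG : {homo G : n m / (n <= m)%N >-> (n <= m)%O}.
  move=> n m nm; apply/subsetPset => z Gz i /= mi; apply: Gz => /=.
  exact: leq_trans mi.
have cG := @nondecreasing_cvg_mu _ _ _ mu G mG mU ndG.
rewrite -(cvg_lim _ cG)//; apply: lime_le; first by apply/cvg_ex; eexists; exact: cG.
apply: nearW => n; apply: le_trans (Fb n); apply: le_measure; rewrite ?inE//.
by move=> z; apply => /=.
Qed.

Variables (mu nu : {measure set RT -> \bar R}) (k : R).
Hypotheses (rmu : radon mu) (rnu : radon nu) (k1 : 1 <= k).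
Hypothesis hk : comparable_hats nu k.
Hypothesis nu_gt0 : forall x r, 0 < r -> 0 < hmass nu x r.

Local Notation M := (hmass mu).
Local Notation N := (hmass nu).
Local Notation dens := (dens mu nu).
Local Notation defect := (entropy_defect mu nu).

(** Scaling the smaller hat by [a^-1] makes it Lipschitz enough for the larger ball; with the factor
    [2] in [discr] this costs [a / 2]. *)
Lemma discr_hat e r p q a : 0 < r -> 0 < q -> 0 < a -> ball p q `<=` ball e r ->
  2 * r <= a * q -> forall b, (alpha_s mu nu (e - r) (e + r) <= b%:E)%E ->
  `|M p q / M e r - N p q / N e r| <= a / 2 * b.
Proof.
move=> r0 q0 a0 pe rq b ab; pose f y := a^-1 * hat p q y.
have lip y z : `|f y - f z| <= `|y - z| / (2 * r).
  rewrite /f -mulrBr normrM gtr0_norm ?invr_gt0//.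
  apply: le_trans (ler_wpM2l _ (hat_lip p y z q0)) _; first by rewrite invr_ge0 ltW.
  by rewrite mulrCA ler_wpM2l// -invfM lef_pV2 ?posrE ?mulr_gt0.
have z0 y : ~ ball e r y -> f y = 0.
  move=> yN; rewrite /f hat_eq0 ?mulr0// leNgt; apply/negP => yp; apply: yN; apply: pe.
  by rewrite /ball/= distrC.
have := le_trans (alpha_s_lb rmu rnu r0 lip z0) ab; rewrite lee_fin /discr /f.
rewrite !RintegralZl//; try exact: integrable_hat.
rewrite -/(M p q) -/(N p q) => h.
have E : 2 * (a^-1 * M p q) / M e r - 2 * (a^-1 * N p q) / N e r =
   2 / a * (M p q / M e r - N p q / N e r) by rewrite mulrBr !mulrA.
have a2 : 0 < 2 / a by rewrite divr_gt0.
by rewrite E normrM (gtr0_norm a2) -ler_pdivlMl// invfM invrK (mulrC 2^-1) in h.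
Qed.

(** [discr_hat] is applied to the node and to its child inside the ball about [e], which contains
    both as [3 * q + q <= r]. Since [r < 8 * q], the ratios [a] are [16] and [32]. *)
Lemma alpha_dev e r p q c b : 0 < q -> `|e - p| < 3 * q -> 4 * q <= r < 8 * q ->
  child p q c -> (alpha_s mu nu (e - r) (e + r) <= b%:E)%E ->
  `|M c (q / 2) * N p q - N c (q / 2) * M p q| <= 32 * k * b * (M p q * N p q).
Proof.
move=> q0 ep /andP[qr rq] cp ab; have r0 : 0 < r by lra.
have q20 : 0 < q / 2 by rewrite divr_gt0.
have pe : ball p q `<=` ball e r.
  move=> z; rewrite /ball/= => pz; have := ler_distD p e z; move: ep pz; rewrite (distrC p z); lra.
have ce : ball c (q / 2) `<=` ball e r.
  move=> z; rewrite /ball/= => pz; have := ler_distD c e z; have := ler_distD p e c.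
  have := child_dist q0 cp; rewrite (distrC c p); lra.
have h1 : `|M p q / M e r - N p q / N e r| <= 16 / 2 * b.
  by apply: discr_hat => //; lra.
have h2 : `|M c (q / 2) / M e r - N c (q / 2) / N e r| <= 32 / 2 * b.
  by apply: discr_hat => //; lra.
have b0 : 0 <= b by have := le_trans (normr_ge0 _) h1; lra.
have Mc := hmass_child rmu q0 cp; have Mc0 := hmass_ge0 mu c (q / 2).
have Mp0 := hmass_ge0 mu p q; have Np0 := nu_gt0 p q0.
have Me0 := hmass_ge0 mu e r; have Ne0 := nu_gt0 e r0.
(* The hats satisfy this bound pointwise. It disposes of the case of a vanishing [M e r], where the
   normalisation degenerates. *)
have Mpe : M p q <= 4 * M e r.
  rewrite -lee_fin EFinM !EFin_hmass// -ge0_integralZl//; last 2 first.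
  - by apply/measurable_EFinP; exact: measurable_hat.
  - by move=> y _; rewrite lee_fin hat_ge0.
  apply: le_integral_ge0 => y _; rewrite -?EFinM lee_fin ?hat_ge0//.
  have [yp|py] := ltP `|y - p| q; last by rewrite (hat_eq0 q0 py) mulr_ge0// hat_ge0.
  rewrite {1}/hat ge_max mulr_ge0 ?hat_ge0//=; have := hat_ge e r y.
  have : `|y - e| / r <= (3 * q + `|y - p|) / (4 * q).
    apply: ler_pM; rewrite ?invr_ge0 ?(ltW r0)//.
      by have := ler_distD p y e; rewrite (distrC p e); lra.
    by rewrite lef_pV2 ?posrE// mulr_gt0.
  rewrite (_ : (3 * q + `|y - p|) / (4 * q) = 3 / 4 + (`|y - p| / q) / 4); first lra.
  by field; rewrite gt_eqF.
have [Me|/eqP Me] := eqVneq (M e r) 0.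
  have Mp : M p q = 0 by lra.
  have -> : M c (q / 2) = 0 by lra.
  by rewrite Mp !(mul0r, mulr0) subrr normr0.
have {Me0}Me0 : 0 < M e r by rewrite lt_neqAle eq_sym Me0 andbT; apply/eqP.
set m := M p q / M e r in h1; set m' := M c (q / 2) / M e r in h2.
set n := N p q / N e r in h1; set n' := N c (q / 2) / N e r in h2.
have Em : M p q = m * M e r by rewrite /m divfK// gt_eqF.
have Em' : M c (q / 2) = m' * M e r by rewrite /m' divfK// gt_eqF.
have En : N p q = n * N e r by rewrite /n divfK// gt_eqF.
have En' : N c (q / 2) = n' * N e r by rewrite /n' divfK// gt_eqF.
have m0 : 0 <= m by rewrite /m divr_ge0// ltW.
have m'0 : 0 <= m' by rewrite /m' divr_ge0// ltW.
clearbody m m' n n'.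
have mm : m' <= 2 * m.
  rewrite -(ler_pM2r Me0) (_ : 2 * m * M e r = 2 * (m * M e r)); last by ring.
  by rewrite -Em -Em'.
(* Arranged so that every term carries [m] or [m'], with [m' <= 2 * m]. The factor [m] then turns
   [M e r] into [M p q], and only [nu] has to be compared across scales. *)
have key : `|m' * n - n' * m| <= 32 * b * m.
  rewrite (_ : m' * n - n' * m = m * (m' - n') - m' * (m - n)); last by ring.
  apply: le_trans (ler_normB _ _) _; rewrite !normrM (ger0_norm m0) (ger0_norm m'0).
  have e1 : m * `|m' - n'| <= m * (32 / 2 * b) by rewrite ler_wpM2l.
  have e2 : m' * `|m - n| <= 2 * m * (16 / 2 * b) by rewrite ler_pM.
  lra.
have NN : N e r <= k * N p q by apply: hk => //; lra.
rewrite {1}Em {1}En Em' En'.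
rewrite (_ : _ - _ = (m' * n - n' * m) * (M e r * N e r)); last by ring.
rewrite normrM (ger0_norm (_ : 0 <= M e r * N e r)); last by rewrite mulr_ge0// ltW.
apply: le_trans (ler_wpM2r _ key) _; first by rewrite mulr_ge0// ltW.
rewrite (_ : _ * _ = 32 * b * M p q * N e r); last by rewrite Em; ring.
rewrite (_ : 32 * k * b * _ = 32 * b * M p q * (k * N p q)); last by ring.
by rewrite ler_wpM2l// !mulr_ge0.
Qed.

(** By [alpha_dev], [N' * |D' - D|] is at most [32 * k * b * M p q]. Squaring and dividing by
    [N' >= N p q / k] gives a common bound for the children; their weights add up to [2], whence
    [2048 = 2 * 32 ^ 2], and [D <= 1 + D]. *)
Lemma defect_le e r p q b : 0 < q -> `|e - p| < 3 * q -> 4 * q <= r < 8 * q ->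
  (alpha_s mu nu (e - r) (e + r) <= b%:E)%E ->
  defect p q <= 2048 * k ^+ 3 * b ^+ 2 * M p q.
Proof.
move=> q0 ep qr ab; have k0 : 0 <= k by exact: le_trans k1.
set D := dens p q; have D0 : 0 <= D by exact: dens_ge0.
have Np0 := nu_gt0 p q0; have Mp0 := hmass_ge0 mu p q.
pose C := (32 * k * b) ^+ 2 * k * M p q * D.
have C0 : 0 <= C by rewrite /C; do 3 (apply: mulr_ge0 => //); exact: sqr_ge0.
have : refine (fun c s => N c s * (dens c s - D) ^+ 2) p q <= refine (fun _ _ => C) p q.
  apply: refine_le => c cp; have q20 : 0 < q / 2 by rewrite divr_gt0.
  have Nc0 := nu_gt0 c q20; have := alpha_dev q0 ep qr cp ab.
  rewrite (densE mu nu_gt0 c q20) (densE mu nu_gt0 p q0) -/D; set D' := dens c _.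
  rewrite (_ : _ - _ = N c (q / 2) * N p q * (D' - D)); last by ring.
  rewrite normrM (gtr0_norm (_ : 0 < N c (q / 2) * N p q)) ?mulr_gt0//.
  set a := `|D' - D| => h.
  have h1 : N c (q / 2) * a <= 32 * k * b * (N p q * D).
    rewrite -(ler_pM2l Np0); move: h; lra.
  have a0 : 0 <= a by rewrite /a normr_ge0.
  rewrite (_ : (D' - D) ^+ 2 = a ^+ 2); last by rewrite /a -normrX ger0_norm ?sqr_ge0.
  rewrite -(ler_pM2l Nc0).
  rewrite (_ : _ * (_ * a ^+ 2) = (N c (q / 2) * a) ^+ 2); last by ring.
  apply: (@le_trans _ _ ((32 * k * b * (N p q * D)) ^+ 2)).
    have Na : 0 <= N c (q / 2) * a by rewrite mulr_ge0// ltW.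
    by rewrite lerXn2r// nnegrE// (le_trans Na h1).
  rewrite /C (densE mu nu_gt0 p q0) -/D.
  rewrite (_ : (32 * k * b * (N p q * D)) ^+ 2 =
    ((32 * k * b) ^+ 2 * N p q * D * D) * N p q); last by ring.
  rewrite (_ : N c (q / 2) * _ =
    ((32 * k * b) ^+ 2 * N p q * D * D) * (k * N c (q / 2))); last by ring.
  rewrite ler_wpM2l ?(hmass_parent_le hk)//.
  by do 3 (apply: mulr_ge0; rewrite ?(ltW Np0)//); exact: sqr_ge0.
rewrite {2}/refine => h; rewrite /entropy_defect -/D ler_pdivrMr; last by lra.
apply: le_trans h _.
have -> : 2^-1 * C + C + 2^-1 * C = 2048 * k ^+ 3 * b ^+ 2 * M p q * D.
  by rewrite /C; field.
apply: ler_wpM2l; last by rewrite lerDr.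
apply: mulr_ge0 Mp0; apply: mulr_ge0; last exact: sqr_ge0.
by apply: mulr_ge0; [exact: ler0n|exact: exprn_ge0].
Qed.

End SingularPart.


(** * Points with bounded square function in a [nu]-null set *)

Section SingularNull.
Context {R : realType}.
Implicit Types (x y z r p q t e : R) (X Y : R -> R -> R).
Notation RT := (measurableTypeR R).
Variables (mu nu : {measure set RT -> \bar R}) (K1 : R).
Hypotheses (rmu : radon mu) (rnu : radon nu).
Hypothesis nu_gt0 : forall x r, 0 < r -> 0 < hmass nu x r.

Local Notation M := (hmass mu).
Local Notation N := (hmass nu).
Local Notation dens := (dens mu nu).
Local Notation defect := (entropy_defect mu nu).

Hypothesis K1_gt0 : 0 < K1.
Hypothesis defectK : forall e r p q b, 0 < q -> `|e - p| < 3 * q -> 4 * q <= r < 8 * q ->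
  (alpha_s mu nu (e - r) (e + r) <= b%:E)%E -> defect p q <= K1 * b ^+ 2 * M p q.

Variables (E : set R) (K x0 : R).
Hypothesis EK : forall e, E e -> (sq_fun mu nu e <= K%:E)%E.
(* Generation [n] of the tree has scale [rn n = r0 / 2 ^+ n], so that the radii
   between [4 * rn n] and [8 * rn n] used in [defectK] form [tile n]. *)
Let r0 : R := 2^-1 ^+ 3.

(** Replaces restricting [mu] to [E], which need not be measurable. *)
Definition touches p q : R := (`[< exists2 e, E e & `|e - p| < q >])%:R.
Local Notation good := touches.

Lemma touches_ge0 p q : 0 <= good p q.
Proof. by rewrite /touches; case: asbool. Qed.

Lemma touches_le1 p q : good p q <= 1.
Proof. by rewrite /touches; case: asbool. Qed.

Lemma touches_child p q c : 0 < q -> child p q c -> good p q = 0 -> good c (q / 2) = 0.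
Proof.
move=> q0 cp; rewrite /touches; case: asboolP => [_ /eqP|h _].
  by rewrite oner_eq0.
case: asboolP => // -[e Ee ec]; exfalso; apply: h; exists e => //.
have := ler_distD c e p; have := child_dist q0 cp; lra.
Qed.

(** Dividing by [M] makes the defect a weight on hats whose integral against [mu] returns the
    defect, so that it can be estimated pointwise. *)
Definition rel_defect p q : R := good p q * (defect p q / M p q).

Lemma rel_defect_ge0 p q : 0 <= rel_defect p q.
Proof.
by rewrite mulr_ge0 ?touches_ge0// divr_ge0 ?hmass_ge0// entropy_defect_ge0.
Qed.

Let r0_gt0 : 0 < r0. Proof. exact: half_lt1. Qed.
Let rn n : R := r0 / 2 ^+ n.
Let rn_gt0 n : 0 < rn n. Proof. by rewrite divr_gt0// exprn_gt0. Qed.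
Let rnE n : rn n = 8^-1 * 2^-1 ^+ n.
Proof. by rewrite /rn -exprVn; congr (_ * _); rewrite /r0 !exprS expr0; lra. Qed.

Lemma rel_defect_le n r e y b p : tile n r -> E e -> `|e - y| < 2 * rn n ->
  (alpha_s mu nu (e - r) (e + r) <= b%:E)%E ->
  rel_defect p (rn n) * hat p (rn n) y <= K1 * b ^+ 2 * hat p (rn n) y.
Proof.
move=> /tileE; rewrite exprS => rt Ee ey ab.
have [->|h0] := eqVneq (hat p (rn n) y) 0; first by rewrite !mulr0.
rewrite ler_wpM2r ?hat_ge0//; have yp := hat_neq0_lt (rn_gt0 n) h0.
have h : defect p (rn n) <= K1 * b ^+ 2 * M p (rn n).
  apply: (defectK (e := e) (r := r)) => //.
    by have := ler_distD y e p; lra.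
  by move: rt; rewrite rnE => /andP[h1 h2]; apply/andP; split; lra.
have b0 : 0 <= K1 * b ^+ 2 by rewrite mulr_ge0 ?sqr_ge0// ltW.
rewrite /rel_defect; have [->|M0] := eqVneq (M p (rn n)) 0.
  by rewrite invr0 !mulr0.
have {}M0 : 0 < M p (rn n) by rewrite lt_neqAle eq_sym M0 hmass_ge0.
have h' : defect p (rn n) / M p (rn n) <= K1 * b ^+ 2 by rewrite ler_pdivrMr.
apply: le_trans h'; rewrite ler_piMl ?touches_le1//.
by rewrite divr_ge0 ?hmass_ge0// entropy_defect_ge0.
Qed.

Let T n y : R := tree n (fun p q => rel_defect p q * hat p q y) x0 r0.

(** Let [m] be the last generation below [L] at which a node through [y] meets [E], at the point
    [e]. As radii shrink, this one [e] is close enough to [y] for every generation up to [m], so all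
    terms are controlled by alpha-numbers centred at [e], whose sum is at most [2 * K]. Later terms
    vanish. *)
Lemma sum_rel_defect L y : 0 <= K -> \sum_(n < L) T n y <= 2 * K1 * K * hat x0 r0 y.
Proof.
move=> K0; set h := hat x0 r0 y; have h0 : 0 <= h by exact: hat_ge0.
have T0 n : 0 <= T n y by apply: tree_hat_ge0; exact: rel_defect_ge0.
pose P n := exists2 p, good p (rn n) = 1 & `|y - p| < rn n.
have NP n : ~ P n -> T n y = 0.
  move=> nP; rewrite /T -(tree0 n x0 r0); apply: eq_tree => p; rewrite -/(rn n).
  have [->|hp] := eqVneq (hat p (rn n) y) 0; first by rewrite mulr0.
  rewrite /rel_defect; have [g1|g1] := eqVneq (good p (rn n)) 1.
    by exfalso; apply: nP; exists p => //; exact: hat_neq0_lt hp.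
  suff -> : good p (rn n) = 0 by rewrite !mul0r.
  by move: g1; rewrite /touches; case: asbool => //; rewrite eqxx.
case: (last_lt P L) => [nP|[m [mL [p gp yp] mmax]]].
  rewrite big1 => [|n _]; last exact: NP _ (nP _ (ltn_ord n)).
  by rewrite !mulr_ge0// ltW.
have [e Ee ep] : exists2 e, E e & `|e - p| < rn m.
  by move: gp; rewrite /touches; case: asboolP => // _ /eqP; rewrite eq_sym oner_eq0.
have ey : `|e - y| < 2 * rn m by have := ler_distD p e y; rewrite (distrC p y); lra.
have key n r : (n <= m)%N -> tile n r -> forall b,
    (alpha_s mu nu (e - r) (e + r) <= b%:E)%E -> T n y <= K1 * b ^+ 2 * h.
  move=> nm nr b ab; rewrite /T /h -(tree_hat n) -?treeZ//; apply: ler_tree => s.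
  apply: (rel_defect_le (e := e) (r := r)) => //; apply: lt_le_trans ey _.
  by rewrite ler_pM2l// !rnE ler_pM2l// half_mono.
have Tm n : (n < L)%N -> (m < n)%N -> T n y = 0.
  move=> nL mn; apply: NP => Pn; have := mmax _ nL Pn; by rewrite leqNgt mn.
have r_in n : tile n (2^-1 ^+ n.+1 : R).
  by apply/tileE; rewrite lexx exprS gtr_pMl ?half_lt1// invf_lt1// ltr1n.
have fin r : 0 < r -> exists2 b, 0 <= b & alpha_s mu nu (e - r) (e + r) = b%:E.
  move=> r_gt0; have a0 := alpha_s_ge0 e rmu rnu r_gt0; have a2 := alpha_s_le2 e rmu rnu r_gt0.
  have af : alpha_s mu nu (e - r) (e + r) \is a fin_num.
    by rewrite ge0_fin_numE// (le_lt_trans a2)// ltry.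
  by exists (fine (alpha_s mu nu (e - r) (e + r))); rewrite ?fine_ge0// fineK.
(* Normalised to lie below the squared alpha-numbers. If [h] vanishes, division yields [0], and the
   conclusion is proved separately. *)
pose u n : R := T n y / (K1 * h).
have u0 n : 0 <= u n by rewrite /u divr_ge0// mulr_ge0// ltW.
have h_dich : h = 0 \/ 0 < h.
  by have [|hn] := eqVneq h 0; [left|right; rewrite lt_neqAle eq_sym hn].
have ua n r : (n < L)%N -> tile n r ->
    ((u n)%:E <= alpha_s mu nu (e - r) (e + r) * alpha_s mu nu (e - r) (e + r))%E.
  move=> nL nr; have /andP[r_gt0 _] := tile_sub01 nr.
  have [b b0 ab] := fin r r_gt0; rewrite ab -EFinM lee_fin.
  have [mn|nm] := ltnP m n; first by rewrite /u Tm// mul0r mulr_ge0.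
  case: h_dich => [h_eq0|h_gt0].
    by rewrite /u h_eq0 mulr0 invr0 mulr0 mulr_ge0.
  rewrite /u ler_pdivrMr ?mulr_gt0//.
  have := key n r nm nr b; rewrite ab lexx => /(_ isT); rewrite expr2; lra.
have := le_trans (sq_fun_ge rmu rnu u0 ua) (EK Ee); rewrite lee_fin => sumu.
case: h_dich => [h_eq0|h_gt0].
  rewrite h_eq0 mulr0 big1// => n _; have [mn|nm] := ltnP m n; first exact: Tm.
  have [b b0 ab] := fin _ (half_lt1 n.+1); have := key n _ nm (r_in n) b.
  by rewrite ab lexx h_eq0 mulr0 => /(_ isT) Tle; apply/le_anti; rewrite Tle T0.
have -> : \sum_(n < L) T n y = (K1 * h) * \sum_(n < L) u n.
  rewrite mulr_sumr; apply: eq_bigr => n _; rewrite /u mulrC divfK// gt_eqF// mulr_gt0//.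
rewrite (_ : 2 * K1 * K * h = (K1 * h) * (2 * K)); last by ring.
rewrite ler_pM2l ?mulr_gt0//; lra.
Qed.

Lemma sum_good_defect L : 0 <= K ->
  \sum_(n < L) tree n (fun p q => good p q * defect p q) x0 r0 <= 2 * K1 * K * M x0 r0.
Proof.
move=> K0; have -> : \sum_(n < L) tree n (fun p q => good p q * defect p q) x0 r0 =
    \sum_(n < L) tree n (fun p q => rel_defect p q * M p q) x0 r0.
  apply: eq_bigr => n _; apply: eq_tree => p; rewrite -/(rn n) /rel_defect.
  (* For a node without [mu]-mass [rel_defect] is [0] by the division convention; so is the defect,
     since the children have no mass either. *)
  have [M0|M0] := eqVneq (M p (rn n)) 0; last by rewrite -mulrA divfK.
  suff -> : defect p (rn n) = 0 by rewrite M0 !mulr0.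
  have D0 : dens p (rn n) = 0 by rewrite /dens M0 mul0r.
  rewrite /entropy_defect D0 (@eq_refine _ _ (fun _ _ => 0)) /refine; first lra.
  move=> c cp; suff -> : dens c (rn n / 2) = 0 by rewrite subrr expr0n mulr0.
  rewrite /dens; suff -> : M c (rn n / 2) = 0 by rewrite mul0r.
  by have := hmass_child rmu (rn_gt0 n) cp; have := hmass_ge0 mu c (rn n / 2); lra.
have mT n : measurable_fun [set: RT] (T n : RT -> R) by exact: measurable_tree_hat.
have T0 n y : 0 <= T n y by apply: tree_hat_ge0; exact: rel_defect_ge0.
have C0 : 0 <= 2 * K1 * K by rewrite !mulr_ge0// ltW.
rewrite -lee_fin -sumEFin EFinM EFin_hmass// -ge0_integralZl//; last 2 first.
- by apply/measurable_EFinP; exact: measurable_hat.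
- by move=> y _; rewrite lee_fin hat_ge0.
rewrite (eq_bigr (fun n : 'I_L => \int[mu]_y (T n y)%:E)%E); last first.
  by move=> n _; rewrite integral_tree//; exact: rel_defect_ge0.
rewrite -ge0_integral_sum//; last 2 first.
- by move=> n; apply/measurable_EFinP; exact: mT.
- by move=> n y _; rewrite lee_fin; exact: T0.
apply: le_integral_ge0 => y _.
  by apply: sume_ge0 => n _; rewrite lee_fin; exact: T0.
by rewrite sumEFin -EFinM lee_fin; exact: sum_rel_defect.
Qed.

Let V p q : R := good p q * (M p q * ln (1 + dens p q)).
Let ln_ge0' p q : 0 <= ln (1 + dens p q).
Proof. by rewrite ln_ge0// lerDl dens_ge0. Qed.

(** [refine_entropy] survives the weights: children of a node missing [E] miss [E] too, and dropping
    children of a node meeting [E] only lowers the nonnegative entropy. *)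
Lemma tree_entropy_le n : 0 <= K ->
  tree n V x0 r0 <= V x0 r0 + 2 * K1 * K * M x0 r0.
Proof.
move=> K0; apply: (@le_trans _ _ (V x0 r0 +
    \sum_(m < n) tree m (fun p q => good p q * defect p q) x0 r0)); last first.
  by rewrite lerD2l; exact: sum_good_defect.
elim: n => [|n IH]; first by rewrite big_ord0 addr0.
rewrite treeSr big_ord_recr/= addrA; apply: le_trans (lerD IH (lexx _)).
rewrite -treeDl; apply: ler_tree => p; rewrite -/(rn n).
have rn0 := rn_gt0 n; have [g0|g1] : good p (rn n) = 0 \/ good p (rn n) = 1.
- by rewrite /touches; case: asbool; [right|left].
- rewrite /V g0 !mul0r addr0 (@eq_refine _ _ (fun _ _ => 0)) /refine; first lra.
  by move=> c cp; rewrite (touches_child rn0 cp g0) mul0r.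
rewrite /V g1 !mul1r; apply: le_trans (refine_entropy rmu rnu nu_gt0 p rn0).
apply: refine_le => c _; rewrite ler_piMl ?touches_le1// mulr_ge0 ?hmass_ge0//.
Qed.

Lemma negligible_singular (Z : set RT) : 0 <= K -> measurable Z -> nu Z = 0%E ->
  (forall e, E e -> `|e - x0| < r0 / 2) -> mu.-negligible (E `&` Z).
Proof.
move=> K0 mZ nuZ Ex0; apply: negligible_small => e e0.
pose C := V x0 r0 + 2 * K1 * K * M x0 r0.
have C0 : 0 <= C.
  by apply: le_trans (tree_entropy_le 0 K0); rewrite mulr_ge0 ?touches_ge0// mulr_ge0// hmass_ge0.
(* With [G = ln (1 + lam)], nodes meeting [E] of density above [lam] have total mass at most
   [C / G <= e / 4]. Nodes of density at most [lam] inside [U] have mass at most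
   [lam * nu U <= e / 4]. *)
pose G := 4 * (C + 1) / e; have G0 : 0 < G by rewrite divr_gt0// mulr_gt0// ltr_wpDl.
pose lam := expR G - 1.
have lamG : ln (1 + lam) = G by rewrite /lam addrC subrK expRK.
have lam0 : 0 < lam by rewrite subr_gt0 expR_gt1.
have d0 : 0 < e / (4 * lam) by rewrite divr_gt0// mulr_gt0.
have [U [oU ZU nuU]] := null_set_open_cover x0 r0 rnu mZ nuZ d0.
have mU : measurable (U : set RT) by exact: open_measurable.
pose inU p q : R := (`[< ball p q `<=` U >])%:R.
have inU0 p q : 0 <= inU p q by rewrite /inU; case: asbool.
pose low p q : R := (dens p q <= lam)%R%:R * inU p q.
pose w p q := G^-1 * (good p q * ln (1 + dens p q)) + low p q.
have low0 p q : 0 <= low p q by rewrite mulr_ge0.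
have w0 p q : 0 <= w p q.
  by rewrite addr_ge0// mulr_ge0 ?invr_ge0 ?(ltW G0)// mulr_ge0 ?touches_ge0.
pose f n y := tree n (fun p q => w p q * hat p q y) x0 r0.
have f0 n y : 0 <= f n y by exact: tree_hat_ge0.
have mf n : measurable_fun [set: RT] (f n : RT -> R) by exact: measurable_tree_hat.
have inU_le n : tree n (fun p q => inU p q * N p q) x0 r0 <= e / (4 * lam).
  rewrite -lee_fin -integral_tree//; apply: le_trans nuU.
  rewrite -[X in (_ <= nu X)%E]setIT -integral_indic//.
  apply: le_integral_ge0 => y _; first by rewrite lee_fin; exact: tree_hat_ge0.
  rewrite lee_fin; apply: (@le_trans _ _ (\1_U y * hat x0 r0 y)); last first.
    by rewrite ler_piMr// hat_le1.
  rewrite -(tree_hat n) -?treeZ//; apply: ler_tree => p; rewrite -/(rn n) indicE.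
  have [->|hp] := eqVneq (hat p (rn n) y) 0; first by rewrite !mulr0.
  rewrite ler_wpM2r ?hat_ge0// /inU; case: asboolP => // pU.
  rewrite mem_set//; apply: pU; rewrite /ball/= distrC; exact: hat_neq0_lt hp.
have intf n : (\int[mu]_y (f n y)%:E <= (e / 2)%:E)%E.
  rewrite integral_tree// lee_fin.
  have -> : tree n (fun p q => w p q * M p q) x0 r0 =
      G^-1 * tree n V x0 r0 + tree n (fun p q => low p q * M p q) x0 r0.
    by rewrite -treeZ -treeDl; apply: eq_tree => p; rewrite /w /V; ring.
  have h1 : tree n V x0 r0 <= C by exact: tree_entropy_le.
  have h2 : tree n (fun p q => low p q * M p q) x0 r0 <= lam * (e / (4 * lam)).
    apply: le_trans (ler_wpM2l (ltW lam0) (inU_le n)).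
    rewrite -treeZ; apply: ler_tree => p; rewrite -/(rn n) /low.
    rewrite (densE mu nu_gt0 p (rn_gt0 n)); case: (leP (dens p (rn n)) lam) => dl.
      rewrite mul1r (_ : lam * _ = inU p (rn n) * (N p (rn n) * lam)); last by ring.
      by rewrite ler_wpM2l// ler_wpM2l// hmass_ge0.
    by rewrite !mul0r mulr_ge0 ?(ltW lam0)// mulr_ge0// hmass_ge0.
  have h3 : G^-1 * tree n V x0 r0 <= e / 4.
    apply: (@le_trans _ _ (G^-1 * C)).
      by rewrite ler_wpM2l// invr_ge0 ltW.
    have C1 : 0 < C + 1 by rewrite ltr_wpDl.
    rewrite (_ : G^-1 * C = e / 4 * (C / (C + 1))); last first.
      by rewrite /G; field; rewrite !gt_eqF.
    rewrite ler_piMr ?divr_ge0 ?(ltW e0)// ler_pdivrMr// mul1r; lra.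
  have h4 : lam * (e / (4 * lam)) = e / 4 by field; rewrite gt_eqF.
  lra.
(* The threshold [1/2] is the least value of the root hat on the half ball containing [E]; Chebyshev
   gives [F n] measure at most [e]. *)
pose F n : set RT := [set y | 2^-1 <= f n y].
have mF n : measurable (F n).
  rewrite (_ : F n = setT `&` f n @^-1` `[2^-1, +oo[%classic).
    by apply: mf => //; exact: measurable_itv.
  by rewrite setTI; apply/seteqP; split => y; rewrite /F/= in_itv/= andbT.
have muF n : (mu (F n) <= e%:E)%E.
  rewrite -[X in (mu X <= _)%E]setIT -integral_indic//.
  apply: (@le_trans _ _ (\int[mu]_y (2%:E * (f n y)%:E))%E).
    apply: le_integral_ge0 => y _; rewrite -?EFinM lee_fin//.
    rewrite indicE; case: (boolP (y \in F n)) => [|_]; last by rewrite mulr_ge0.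
    by rewrite inE /F /=; lra.
  rewrite ge0_integralZl//; last 2 first.
  - by apply/measurable_EFinP; exact: mf.
  - by move=> y _; rewrite lee_fin.
  apply: le_trans (lee_wpmul2l _ (intf n)) _; first by rewrite lee_fin.
  by rewrite -EFinM lee_fin; lra.
have [mA muA] := measure_liminf_le mF muF.
exists (\bigcup_m \bigcap_(n in [set n | (m <= n)%N]) F n); split => // y [Ey Zy].
have yx := Ex0 _ Ey.
have Uy : U y by apply: ZU; split => //; rewrite /ball/= distrC; have := r0_gt0; lra.
have [eps /= eps0 yU] : exists2 eps : R, 0 < eps & ball y eps `<=` U.
  by have /nbhs_ballP[eps eps0 h] := oU y Uy; exists eps.
(* From this depth on, nodes through [y] lie in [U]. The depth depends on [y], hence the passage to
   the lower limit of the sets [F n]. *)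
have [m hm] : exists m, 2 * rn m <= eps.
  exists (Num.truncn (2 * r0 / eps)).+1; rewrite /rn mulrA ler_pdivrMr ?exprn_gt0//.
  rewrite (mulrC eps) -ler_pdivrMr//; apply: ltW; apply: lt_trans (truncnS_gt _) _.
  by rewrite -natrX ltr_nat ltn_expl.
exists m => // n /= mn; rewrite /F/=.
apply: (@le_trans _ _ (hat x0 r0 y)).
  apply: le_trans (hat_ge x0 r0 y).
  have : `|y - x0| / r0 <= 2^-1 by rewrite ler_pdivrMr// mulrC ltW.
  lra.
rewrite -(tree_hat n)//; apply: ler_tree => p; rewrite -/(rn n).
have [->|hp] := eqVneq (hat p (rn n) y) 0; first by rewrite !mulr0.
rewrite ler_peMl ?hat_ge0//; have yp := hat_neq0_lt (rn_gt0 n) hp.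
have g1 : good p (rn n) = 1.
  by rewrite /touches; case: asboolP => // h; exfalso; apply: h; exists y.
rewrite /w /low g1 mul1r; case: (leP (dens p (rn n)) lam) => dl.
  rewrite mul1r /inU; case: asboolP => [_|h].
    by rewrite lerDr mulr_ge0 ?invr_ge0 ?(ltW G0).
  exfalso; apply: h => z pz; apply: yU; rewrite /ball/=.
  have rnm : rn n <= rn m by rewrite !rnE ler_pM2l// half_mono.
  move: pz; rewrite /ball/= => pz; have := ler_distD p y z; lra.
rewrite mul0r addr0 mulrC ler_pdivlMr// mul1r -lamG ler_ln ?posrE//.
- by rewrite lerD2l ltW.
- by rewrite ltr_wpDr// ltW.
- by rewrite ltr_wpDr// dens_ge0.
Qed.

End SingularNull.

(** * Alpha-numbers and oscillation of the density *)


Section Oscillation.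
Context {R : realType}.
Implicit Types (x y z r p q t e : R) (X Y : R -> R -> R).
Notation RT := (measurableTypeR R).
Variables (mu nu : {measure set RT -> \bar R}).
Hypotheses (rmu : radon mu) (rnu : radon nu).
Hypothesis nu_gt0 : forall x r, 0 < r -> 0 < hmass nu x r.

Local Notation M := (hmass mu).
Local Notation N := (hmass nu).
Local Notation dens := (dens mu nu).
Local Notation osc := (osc mu nu).

(** * Moments of a Lipschitz function and their telescoping *)

Section potential.
Variables (psi : R -> R) (L b : R).
Hypothesis psi_lip : forall y z, `|psi y - psi z| <= L * `|y - z|.
Hypothesis psi_le : forall y, `|psi y| <= b.

Let L_ge0 : 0 <= L.
Proof. by have := le_trans (normr_ge0 _) (psi_lip 1 0); rewrite subr0 normr1 mulr1. Qed.

Definition moment (m : {measure set RT -> \bar R}) p q : R :=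
  \int[m]_y (psi y * hat p q y).

Lemma measurable_psi_hat p q : measurable_fun [set: RT] (fun y : RT => psi y * hat p q y).
Proof.
apply: measurable_funM; last exact: measurable_hat.
exact: lipschitz_measurable psi_lip.
Qed.

Lemma integrable_psi_hat (m : {measure set RT -> \bar R}) p q : radon m -> 0 < q ->
  m.-integrable setT (EFin \o (fun y => psi y * hat p q y)).
Proof.
move=> rm q0; apply: (integrable_dom_hat (x := p) (c := b) rm q0).
  exact: measurable_psi_hat.
by move=> y; rewrite normrM (ger0_norm (hat_ge0 _ _ _)) ler_wpM2r ?hat_ge0.
Qed.

Lemma moment_refine m p q : radon m -> 0 < q -> refine (moment m) p q = moment m p q.
Proof.
move=> rm q0; have q20 : 0 < q / 2 by rewrite divr_gt0.
have I s := integrable_psi_hat s rm q20.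
have IZ s : m.-integrable setT (EFin \o (fun y => 2^-1 * (psi y * hat s (q / 2) y))).
  exact: (integrableZl measurableT 2^-1 (I s)).
rewrite /refine /moment -!RintegralZl//.
rewrite -RintegralD// -RintegralD//; last exact: (integrableD measurableT (IZ _) (I _)).
apply: eq_Rintegral => y _; rewrite -(hat_refine y p q0) /refine; ring.
Qed.

Lemma moment_dev m p q s rho : radon m -> 0 < q -> 0 < rho ->
  (forall y, rho <= `|y - s| -> hat p q y = 0) ->
  `|moment m p q - psi s * hmass m p q| <= L * rho * hmass m p q.
Proof.
move=> rm q0 rho0 h; rewrite /moment /hmass -RintegralZl//; last exact: integrable_hat.
have Is := integrableZl measurableT (psi s) (integrable_hat p rm q0).
rewrite -RintegralB//; last exact: integrable_psi_hat.
apply: (Rintegral_le_ge0 (c := L * rho) rm q0).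
  apply: measurable_funB; first exact: measurable_psi_hat.
  by apply: measurable_funM => //; exact: measurable_hat.
move=> y; rewrite -mulrBl normrM (ger0_norm (hat_ge0 _ _ _)).
have [ys|sy] := ltP `|y - s| rho; last by rewrite h// !mulr0.
rewrite ler_wpM2r ?hat_ge0//; apply: le_trans (psi_lip y s) _.
by rewrite ler_wpM2l// ltW.
Qed.

Definition moment_gap p q : R := `|moment mu p q - dens p q * moment nu p q|.

Lemma moment_gap_le p q : 0 < q -> moment_gap p q <= 2 * L * q * M p q.
Proof.
move=> q0; have h y : q <= `|y - p| -> hat p q y = 0 by exact: hat_eq0.
have h1 := moment_dev rmu q0 q0 h; have h2 := moment_dev rnu q0 q0 h.
rewrite /moment_gap (_ : moment mu p q - _ = (moment mu p q - psi p * M p q) -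
  dens p q * (moment nu p q - psi p * N p q)); last by rewrite (densE mu nu_gt0 p q0); ring.
apply: le_trans (ler_normB _ _) _; rewrite normrM (ger0_norm (dens_ge0 _ _ _ _)).
have := ler_wpM2l (dens_ge0 mu nu p q) h2.
rewrite (_ : dens p q * (L * q * N p q) = L * q * M p q); last first.
  by rewrite (densE mu nu_gt0 p q0); ring.
lra.
Qed.

(** Changing the parent's density to a child's costs [(D' - D)] times a [nu]-moment. By [refine_dev]
    the constant [psi p] may be subtracted from [psi] there, so each moment becomes at most
    [L * q * N']. *)
Lemma moment_gap_refine p q : 0 < q ->
  moment_gap p q <= refine moment_gap p q + L * q * osc p q.
Proof.
move=> q0; have q20 : 0 < q / 2 by rewrite divr_gt0.
rewrite {1}/moment_gap.
have -> : moment mu p q - dens p q * moment nu p q =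
    refine (fun s t => (moment mu s t - dens s t * moment nu s t) +
      (dens s t - dens p q) * (moment nu s t - psi p * N s t)) p q.
  transitivity (refine (fun s t => (moment mu s t + - dens p q * moment nu s t) +
      - psi p * (N s t * (dens s t - dens p q))) p q); last first.
    by apply: eq_refine => s _; ring.
  rewrite refineD refineD !refineZ !moment_refine// refine_dev//; ring.
apply: le_trans (refine_norm _ _ _) _.
rewrite /osc -refineZ -refineD; apply: refine_le => s cs.
apply: le_trans (ler_normD _ _) _; rewrite lerD2l normrM.
have := moment_dev (s := p) rnu q20 q0 (fun y => hat_child q0 cs) => h.
apply: le_trans (ler_wpM2l (normr_ge0 _) h) _.
by rewrite le_eqVlt; apply/orP; left; apply/eqP; ring.
Qed.

(** At depth [m] the cost is proportional to the radius [q / 2 ^ m], which is the source of the gain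
    [2^-1 ^+ m]. The last generation is closed by [moment_gap_le]. *)
Lemma moment_gap_tree n p q : 0 < q ->
  moment_gap p q <=
  L * q * (\sum_(m < n) 2^-1 ^+ m * tree m osc p q + 2 * 2^-1 ^+ n * M p q).
Proof.
move=> q0.
have h : moment_gap p q <= \sum_(m < n) tree m (fun s t => L * t * osc s t) p q +
    tree n moment_gap p q.
  elim: n => [|n IH]; first by rewrite big_ord0 add0r.
  apply: le_trans IH _; rewrite big_ord_recr/= -addrA lerD2l -treeS treeSr -treeDl.
  apply: ler_tree => s; rewrite addrC; apply: moment_gap_refine.
  by rewrite divr_gt0// exprn_gt0.
apply: le_trans h _; rewrite mulrDr mulr_sumr; apply: lerD.
  apply: ler_sum => m _; rewrite (treeZs m (fun t => L * t)) exprVn.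
  by rewrite le_eqVlt; apply/orP; left; apply/eqP; ring.
apply: (@le_trans _ _ (tree n (fun s t => 2 * L * t * M s t) p q)).
  by apply: ler_tree => s; apply: moment_gap_le; rewrite divr_gt0// exprn_gt0.
rewrite (treeZs n (fun t => 2 * L * t)) tree_hmass// exprVn.
by rewrite le_eqVlt; apply/orP; left; apply/eqP; ring.
Qed.

End potential.

(** Writes [f] as [psi * hat p q] with [psi] globally Lipschitz; the floor [1/4] is inactive on the
    support of [f] in the intended use. The slope [24 / q] is [16 / q] from [f] plus [8 / q] from
    the denominator. *)
Lemma lipschitz_quotient (f : R -> R) p r q : 0 < q -> q / 8 <= r ->
  (forall y z, `|f y - f z| <= `|y - z| / (2 * r)) -> (forall y, `|f y| <= 2^-1) ->
  forall y z, `|f y / Num.max (hat p q y) 4^-1 - f z / Num.max (hat p q z) 4^-1| <=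
    24 / q * `|y - z|.
Proof.
move=> q0 qr lip fle y z; have r0 : 0 < r by lra.
pose g w := Num.max (hat p q w) 4^-1.
have g4 w : 4^-1 <= g w by rewrite /g le_max lexx orbT.
have g0 w : 0 < g w by apply: lt_le_trans (g4 w); rewrite invr_gt0.
have gi w : 0 <= (g w)^-1 <= 4.
  rewrite invr_ge0 (ltW (g0 w))/= -[leRHS]invrK.
  by rewrite lef_pV2 ?posrE ?invr_gt0 ?g0 ?g4.
have glip : `|g z - g y| <= `|y - z| / q.
  apply: le_trans _ (hat_lip p y z q0); rewrite /g (distrC (hat p q y)).
  move: (hat p q y) (hat p q z) => a b.
  by case: (leP b) => ?; case: (leP a) => ?; case: (ger0P (b - a)) => ?;
    try (case: ger0P => ?); lra.
rewrite -/(g y) -/(g z).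
have -> : f y / g y - f z / g z =
    (f y - f z) * (g y)^-1 + f z * ((g z - g y) * (g y)^-1 * (g z)^-1).
  by field; rewrite !gt_eqF.
apply: le_trans (ler_normD _ _) _; rewrite !normrM.
have /andP[gy1 gy2] := gi y; have /andP[gz1 gz2] := gi z.
rewrite (ger0_norm gy1) (ger0_norm gz1).
have e1 : `|f y - f z| * (g y)^-1 <= `|y - z| / (2 * r) * 4 by rewrite ler_pM.
have e2 : `|f z| * (`|g z - g y| * (g y)^-1 * (g z)^-1) <= 2^-1 * (`|y - z| / q * 4 * 4).
  by rewrite ler_pM// ?mulr_ge0// ler_pM// ?mulr_ge0// ler_pM.
have e3 : `|y - z| / (2 * r) * 4 <= `|y - z| * (16 / q).
  rewrite (_ : `|y - z| / (2 * r) * 4 = `|y - z| * (2 * r^-1)); last first.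
    by field; rewrite gt_eqF.
  rewrite (_ : 16 / q = 2 * (q / 8)^-1); last by field; rewrite gt_eqF.
  by rewrite ler_wpM2l// ler_pM2l// lef_pV2 ?posrE// divr_gt0.
have e4 : 24 / q * `|y - z| = `|y - z| * (16 / q) + 2^-1 * (`|y - z| / q * 4 * 4).
  by field; rewrite gt_eqF.
by rewrite e4; apply: lerD; [exact: le_trans e3|].
Qed.

Lemma alpha_s_le_osc n x r p q : q / 8 <= r < q / 4 -> `|p - x| <= q / 2 ->
  0 < M x r ->
  (alpha_s mu nu (x - r) (x + r) <= (96 / M x r *
    (\sum_(m < n) 2^-1 ^+ m * tree m osc p q + 2 * 2^-1 ^+ n * M p q))%:E)%E.
Proof.
move=> /andP[qr rq] px Mx; have q0 : 0 < q by lra.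
have r0 : 0 < r by lra.
set S := \sum_(m < n) _ + _.
have Nx := nu_gt0 x r0.
(* a function supported in the ball is a Lipschitz multiple of [hat p q] *)
have gap f : (forall y z, `|f y - f z| <= `|y - z| / (2 * r)) ->
    (forall y, `|f y| <= 2^-1 * hat x r y) ->
    `|\int[mu]_y f y - dens p q * \int[nu]_y f y| <= 24 * S.
  move=> lip fle; have fle2 y : `|f y| <= 2^-1.
    by apply: le_trans (fle y) _; rewrite ler_piMr// hat_le1.
  pose psi y := f y / Num.max (hat p q y) 4^-1.
  have psiE y : psi y * hat p q y = f y.
    have [yx|xy] := ltP `|y - x| r.
      have hy : 4^-1 <= hat p q y.
        apply: le_trans (hat_ge p q y).
        have : `|y - p| / q <= 3 / 4.
          by rewrite ler_pdivrMr//; have := ler_distD x y p; rewrite (distrC x p); lra.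
        lra.
      have h0 : 0 < hat p q y by apply: lt_le_trans hy; rewrite invr_gt0.
      by rewrite /psi (max_idPl hy) divfK// gt_eqF.
    have f0 : f y = 0.
      by apply/eqP; rewrite -normr_le0; apply: le_trans (fle y) _; rewrite hat_eq0 ?mulr0.
    by rewrite /psi f0 !mul0r.
  have psi2 y : `|psi y| <= 2.
    have m4 : 4^-1 <= Num.max (hat p q y) 4^-1 by rewrite le_max lexx orbT.
    have m0 : 0 < Num.max (hat p q y) 4^-1 by apply: lt_le_trans m4; rewrite invr_gt0.
    rewrite /psi normrM normfV (gtr0_norm m0) ler_pdivrMr//.
    by have := fle2 y; lra.
  have := @moment_gap_tree psi (24 / q) 2 (lipschitz_quotient p q0 qr lip fle2) psi2 n p q q0.
  rewrite divfK ?gt_eqF// -/S /moment_gap /moment.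
  by under [in X in `|X - _|]eq_Rintegral do rewrite psiE;
     under [in X in `|_ - _ * X|]eq_Rintegral do rewrite psiE.
apply: alpha_s_ub => // f lip fle; have g1 := gap f lip fle.
(* Half the hat is itself admissible, so [gap] also compares the two normalising masses [M x r] and
   [D * N x r]. The two uses of [gap] give [2 * (24 + 24) = 96]. *)
have lip0 y z : `|2^-1 * hat x r y - 2^-1 * hat x r z| <= `|y - z| / (2 * r).
  rewrite -mulrBr normrM gtr0_norm ?invr_gt0// invfM mulrCA ler_wpM2l ?invr_ge0//.
  exact: hat_lip.
have fle0 y : `|2^-1 * hat x r y| <= 2^-1 * hat x r y.
  by rewrite ger0_norm// mulr_ge0 ?invr_ge0// hat_ge0.
have := gap _ lip0 fle0; rewrite !RintegralZl//; try exact: integrable_hat.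
rewrite -/(M x r) -/(N x r) => g2.
have F2 := Rintegral_le_ge0 rnu r0 (lip2r_measurable r0 lip) fle.
rewrite /discr; set Fm := \int[mu]_y f y in g1 *; set Fn := \int[nu]_y f y in g1 F2 *.
set D := dens p q in g1 g2.
have -> : 2 * Fm / M x r - 2 * Fn / N x r =
    2 / M x r * ((Fm - D * Fn) - (2^-1 * M x r - D * (2^-1 * N x r)) * (2 * Fn / N x r)).
  by field; rewrite !gt_eqF.
rewrite normrM gtr0_norm ?divr_gt0//.
have F3 : `|2 * Fn / N x r| <= 1.
  rewrite normrM normfV (gtr0_norm Nx) ler_pdivrMr// mul1r normrM (@gtr0_norm _ 2)//.
  lra.
have e : `|(Fm - D * Fn) - (2^-1 * M x r - D * (2^-1 * N x r)) * (2 * Fn / N x r)| <=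
    48 * S.
  apply: le_trans (ler_normB _ _) _; rewrite normrM.
  have := ler_pM (normr_ge0 _) (normr_ge0 _) g2 F3; lra.
rewrite (_ : 96 / M x r * S = 2 / M x r * (48 * S)); last by field; rewrite gt_eqF.
by rewrite ler_wpM2l// divr_ge0// ltW.
Qed.

End Oscillation.

(** * The absolutely continuous part *)


Section FiniteSquare.
Context {R : realType}.
Implicit Types (x y z r p q t e : R) (X Y : R -> R -> R).
Notation RT := (measurableTypeR R).

Lemma integral_tree_gen (mu : {measure set RT -> \bar R}) (F : RT -> R -> R -> R)
    (G : R -> R -> R) n x r : 0 < r ->
  (forall y p q, 0 <= F y p q) ->
  (forall p q, measurable_fun [set: RT] (fun y => F y p q)) ->
  (forall p q, 0 < q -> (\int[mu]_y (F y p q)%:E = (G p q)%:E)%E) ->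
  (\int[mu]_y (tree n (F y) x r)%:E = (tree n G x r)%:E)%E.
Proof.
move=> + F0 mF FG; elim: n x r => [|n IH] x r r0; first exact: FG.
rewrite treeS (@integral_refine _ mu (fun y => tree n (F y))).
- by rewrite !IH ?divr_gt0// /refine -!EFinM -!EFinD.
- by move=> y p q; apply: tree_ge0.
- by move=> p q; exact: measurable_tree.
Qed.

Lemma geom_tail (a K : nat) :
  \sum_(m < K) (if (a < m)%N then 2^-1 ^+ m else 0) =
  (if (a < K)%N then 2^-1 ^+ a - 2 * 2^-1 ^+ K else 0 :> R).
Proof.
elim: K => [|K IH]; first by rewrite big_ord0.
rewrite big_ord_recr/= IH ltnS; case: ltngtP => // h.
- by rewrite exprS; lra.
- by rewrite addr0.
- by rewrite h exprS; lra.
Qed.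

Lemma geom_head (a L : nat) :
  \sum_(n < L) (if (n <= a)%N then 2^-1 ^+ (a - n) else 0) <= 2 :> R.
Proof.
suff h : \sum_(n < L) (if (n <= a)%N then 2^-1 ^+ (a - n) else 0) <=
    (if (L <= a)%N then 2^-1 ^+ (a - L) else 2) :> R.
  apply: le_trans h _; case: ifP => // _; have := half_mono (R := R) (leq0n (a - L)).
  by rewrite expr0; lra.
elim: L => [|L IH]; first by rewrite big_ord0 leq0n ltW// half_lt1.
rewrite big_ord_recr/=; case: (ltngtP L a) IH => [La|aL|->] IH.
- move: IH; have -> : (a - L = (a - L.+1).+1)%N by rewrite subnSK.
  by rewrite exprS; lra.
- by rewrite addr0.
- by move: IH; rewrite subnn expr0; lra.
Qed.

Lemma geom_sum (L : nat) : \sum_(m < L) 2^-1 ^+ m <= 2 :> R.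
Proof.
suff -> : \sum_(m < L) 2^-1 ^+ m = 2 - 2 * 2^-1 ^+ L :> R.
  by have := @half_lt1 R L; lra.
elim: L => [|L IH]; first by rewrite big_ord0 expr0; lra.
by rewrite big_ord_recr/= IH exprS; lra.
Qed.

(** Take [t = a / (2 * c)] and multiply by [a]. The term [v] stays linear because [a <= 2]; this is
    what allows the contribution of dense nodes to be summed without squaring. *)
Lemma sqr_le_of_amgm (a c s v w : R) : 0 < c -> 0 <= s -> 0 <= v -> 0 <= w ->
  0 <= a <= 2 -> (forall t, 0 < t -> a <= c * t + s / t + v + w) ->
  a ^+ 2 <= 8 * c * s + 8 * v + 4 * w ^+ 2.
Proof.
move=> c0 s0 v0 w0 /andP[a0 a2] h.
have [->|an0] := eqVneq a 0.
  have := sqr_ge0 w; have : 0 <= c * s by rewrite mulr_ge0// ltW.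
  by rewrite expr0n/=; lra.
have {a0 an0}a0 : 0 < a by rewrite lt_neqAle eq_sym an0.
have t0 : 0 < a / (2 * c) by rewrite divr_gt0// mulr_gt0.
have := h _ t0; rewrite (_ : c * (a / (2 * c)) = a / 2); last by field; rewrite gt_eqF.
rewrite (_ : s / (a / (2 * c)) = 2 * c * s / a); last by field; rewrite !gt_eqF.
move=> /(ler_wpM2l (ltW a0)).
rewrite (_ : a * (a / 2 + _ + v + w) = a ^+ 2 / 2 + 2 * c * s + a * v + a * w); last first.
  by field; rewrite gt_eqF.
have : a * v <= 2 * v by rewrite ler_wpM2r.
have : a * w <= a ^+ 2 / 4 + w ^+ 2.
  rewrite -subr_ge0 (_ : a ^+ 2 / 4 + w ^+ 2 - a * w = (a / 2 - w) ^+ 2) ?sqr_ge0//.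
  by field.
rewrite -expr2; lra.
Qed.

Variables (mu nu : {measure set RT -> \bar R}) (k : R).
Hypotheses (rmu : radon mu) (rnu : radon nu) (k1 : 1 <= k).
Hypothesis hk : comparable_hats nu k.
Hypothesis nu_gt0 : forall x r, 0 < r -> 0 < hmass nu x r.

Local Notation M := (hmass mu).
Local Notation N := (hmass nu).
Local Notation dens := (dens mu nu).
Local Notation osc := (osc mu nu).
Local Notation energy := (energy mu nu).

Variables (E : set R) (lam x0 : R).
Hypothesis lam0 : 0 < lam.
Hypothesis E_hi : forall x p q, E x -> 0 < q <= 4 -> `|x - p| < 3 * q -> dens p q <= lam.
Hypothesis E_lo : forall x r, E x -> 0 < r < 1 -> N x r <= lam * M x r.
Hypothesis E_loc : forall x, E x -> `|x - x0| <= 1.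

Local Notation tch := (touches E).
Definition bad p q : R := if dens p q <= lam then 0 else 1.

Lemma bad_ge0 p q : 0 <= bad p q.
Proof. by rewrite /bad; case: ifP. Qed.

(* The radii in [tile n] lie between [rn n / 8] and [rn n / 4], as required by
   [alpha_s_le_osc]. *)
Let rn n : R := 4 / 2 ^+ n.
Let rn_gt0 n : 0 < rn n. Proof. by rewrite divr_gt0// exprn_gt0. Qed.
Let rnE n : rn n = 4 * 2^-1 ^+ n. Proof. by rewrite /rn exprVn. Qed.
Let rnD n m : rn n / 2 ^+ m = rn (n + m).
Proof. by rewrite /rn exprD invfM mulrA. Qed.
Let rn_le4 n : rn n <= 4.
Proof. by rewrite rnE ler_piMr//; have := half_mono (R := R) (leq0n n); rewrite expr0. Qed.

Let W n p q : R := \sum_(m < n) 2^-1 ^+ m *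
  (tree m energy p q + tch p q * tree m (fun s t => bad s t * M s t) p q).

Let energy_ge0' p q : 0 <= energy p q. Proof. exact: energy_ge0. Qed.
Let badM_ge0 p q : 0 <= bad p q * M p q.
Proof. by rewrite mulr_ge0 ?bad_ge0 ?hmass_ge0. Qed.

Let W_ge0 n p q : 0 <= W n p q.
Proof.
apply: sumr_ge0 => m _; apply: mulr_ge0; first exact: ltW (half_lt1 _).
by rewrite addr_ge0 ?mulr_ge0 ?touches_ge0 ?tree_ge0.
Qed.

(** A descendant at depth [m] of generation [n] has generation [n + m]. Summing over [n] first costs
    at most [N] for each [m], and the gains sum to at most [2]. *)
Lemma sum_tree_energy L :
  \sum_(n < L) tree n (fun p q => \sum_(m < n) 2^-1 ^+ m * tree m energy p q) x0 4 <=
  2 * N x0 4.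
Proof.
have T0 j : 0 <= tree j energy x0 4 by apply: tree_ge0.
apply: (@le_trans _ _ (\sum_(n < L) \sum_(m < L) 2^-1 ^+ m * tree (n + m) energy x0 4)).
  apply: ler_sum => n _.
  have -> : tree n (fun p q => \sum_(m < n) 2^-1 ^+ m * tree m energy p q) x0 4 =
      \sum_(m < n) 2^-1 ^+ m * tree (n + m) energy x0 4.
    rewrite tree_sum; apply: eq_bigr => m _; by rewrite treeZ treeD.
  rewrite (big_ord_widen L (fun m => 2^-1 ^+ m * tree (n + m) energy x0 4)) 1?ltnW//.
  rewrite [leRHS](bigID (fun m : 'I_L => (m < n)%N))/= lerDl.
  by apply: sumr_ge0 => m _; rewrite mulr_ge0// ltW// half_lt1.
rewrite exchange_big/=; apply: (@le_trans _ _ (\sum_(m < L) 2^-1 ^+ m * N x0 4)).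
  apply: ler_sum => m _; rewrite -mulr_sumr ler_wpM2l ?(ltW (half_lt1 _))//.
  apply: le_trans (sum_energy rmu rnu nu_gt0 (m + L) x0 (ltr0Sn R 3)).
  rewrite big_split_ord/= (eq_bigr (fun i : 'I_L => tree (m + i) energy x0 4)).
    by rewrite lerDr sumr_ge0.
  by move=> i _; rewrite addnC.
by rewrite -mulr_suml ler_wpM2r ?hmass_ge0// geom_sum.
Qed.

Let F n y p q : R :=
  \sum_(m < n) 2^-1 ^+ m * tch p q * tree m (fun s t => bad s t * hat s t y) p q.

Let F_ge0 n y p q : 0 <= F n y p q.
Proof.
apply: sumr_ge0 => m _; apply: mulr_ge0.
  by rewrite mulr_ge0 ?touches_ge0 ?(ltW (half_lt1 _)).
by apply: tree_hat_ge0; exact: bad_ge0.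
Qed.

(** Let [a] be the last generation below [L] at which a node through [y] meets [E]. Bad nodes
    through [y] come after [a], so a node of generation [n <= a] sees them only at depths
    [m > a - n], with total gain at most [2^-1 ^+ (a - n)]. Summing over [n] gives [2]. *)
Lemma sum_tree_bad_hat L y : \sum_(n < L) tree n (F n y) x0 4 <= 2 * hat x0 4 y.
Proof.
pose tau n := exists2 p, tch p (rn n) = 1 & `|y - p| < rn n.
have tch01 p q : tch p q = 0 \/ tch p q = 1.
  by rewrite /touches; case: asbool; [right|left].
have tauN n p : ~ tau n -> F n y p (rn n) <= 0.
  move=> nt; have [t0|t1] := tch01 p (rn n).
    by rewrite /F big1// => m _; rewrite t0 mulr0 mul0r.
  have [h0|hp] := eqVneq (hat p (rn n) y) 0; last first.
    by exfalso; apply: nt; exists p => //; exact: hat_neq0_lt hp.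
  apply: sumr_le0 => m _; rewrite pmulr_rle0; last first.
    by rewrite t1 mulr1 half_lt1.
  rewrite -h0 -(tree_hat m)//; apply: ler_tree => s.
  by rewrite ler_piMl ?hat_ge0// /bad; case: ifP.
case: (last_lt tau L) => [nt|[a [aL [p0 tp0 yp0] amax]]].
  apply: (@le_trans _ _ 0); last by rewrite mulr_ge0 ?hat_ge0.
  apply: sumr_le0 => n _; rewrite -(tree0 n x0 4); apply: ler_tree => p.
  by apply: tauN; exact: nt.
have [z Ez zp0] : exists2 z, E z & `|z - p0| < rn a.
  by move: tp0; rewrite /touches; case: asboolP => // _ /eqP; rewrite eq_sym oner_eq0.
(* If [j <= a], the point of [E] is within [rn a + rn a + rn j <= 3 * rn j] of [s], which is where
   the [3] in [E_hi] comes from. *)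
have bada j s : bad s (rn j) != 0 -> hat s (rn j) y != 0 -> (a < j)%N.
  move=> bs hs; have ys := hat_neq0_lt (rn_gt0 j) hs; rewrite ltnNge; apply/negP => ja.
  move: bs; rewrite /bad; have -> : dens s (rn j) <= lam; last by rewrite eqxx.
  apply: (E_hi Ez); first by rewrite rn_gt0 rn_le4.
  have := ler_distD p0 z s; have := ler_distD y p0 s; rewrite (distrC p0 y).
  have : rn a <= rn j by rewrite !rnE ler_pM2l// half_mono.
  lra.
have node n p : (n < L)%N -> F n y p (rn n) <=
    (if (n <= a)%N then 2^-1 ^+ (a - n) else 0) * hat p (rn n) y.
  move=> nL; have [tn|/tauN h] := pselect (tau n); last first.
    apply: le_trans (h p) _; rewrite mulr_ge0 ?hat_ge0//.
    by case: ifP => // _; exact: ltW (half_lt1 _).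
  have na := amax _ nL tn; rewrite na.
  apply: (@le_trans _ _ (\sum_(m < n) (if (a - n < m)%N then 2^-1 ^+ m else 0) *
      hat p (rn n) y)); last first.
    rewrite -mulr_suml ler_wpM2r ?hat_ge0// geom_tail; case: ifP => _.
      by rewrite lerBlDr lerDl mulr_ge0// ltW// half_lt1.
    exact: ltW (half_lt1 _).
  apply: ler_sum => m _; rewrite ltn_subLR//.
  apply: (@le_trans _ _ (2^-1 ^+ m * ((if (a < n + m)%N then 1 else 0) * hat p (rn n) y))).
    apply: ler_pM.
    - by rewrite mulr_ge0 ?touches_ge0 ?(ltW (half_lt1 _)).
    - by apply: tree_hat_ge0; exact: bad_ge0.
    - by rewrite ler_piMr ?touches_le1 ?(ltW (half_lt1 _)).
    rewrite -(tree_hat m)// -treeZ; apply: ler_tree => s; rewrite rnD.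
    have [->|hs] := eqVneq (hat s (rn (n + m)) y) 0; first by rewrite !mulr0.
    rewrite ler_wpM2r ?hat_ge0//.
    have [->|bs] := eqVneq (bad s (rn (n + m))) 0; first by case: ifP.
    by rewrite (bada _ _ bs hs) /bad; case: ifP.
  by case: ifP => _; rewrite ?mul1r ?mul0r ?mulr0.
apply: (@le_trans _ _ (\sum_(n < L) (if (n <= a)%N then 2^-1 ^+ (a - n) else 0) *
    hat x0 4 y)).
  apply: ler_sum => n _; rewrite -(tree_hat n)// -treeZ.
  by apply: ler_tree => p; exact: node.
by rewrite -mulr_suml ler_wpM2r ?hat_ge0// geom_head.
Qed.

Lemma sum_tree_bad L : \sum_(n < L) tree n (fun p q => \sum_(m < n) 2^-1 ^+ m *
    (tch p q * tree m (fun s t => bad s t * M s t) p q)) x0 4 <= 2 * M x0 4.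
Proof.
have mt m p q : measurable_fun [set: RT]
    (fun y => tree m (fun s t => bad s t * hat s t y) p q : R).
  exact: measurable_tree_hat.
have mF n p q : measurable_fun [set: RT] (fun y => F n y p q : R).
  by apply: measurable_sum => m; apply: measurable_funM.
have c0 m p q : 0 <= 2^-1 ^+ m * tch p q.
  by rewrite mulr_ge0 ?touches_ge0 ?(ltW (half_lt1 _)).
have t0 m p q y : 0 <= tree m (fun s t => bad s t * hat s t y) p q.
  by apply: tree_hat_ge0; exact: bad_ge0.
have FG n p q : 0 < q -> (\int[mu]_y (F n y p q)%:E = (\sum_(m < n) 2^-1 ^+ m *
    (tch p q * tree m (fun s t => bad s t * M s t) p q))%:E)%E.
  move=> q0; rewrite /F; under eq_integral do rewrite -sumEFin.
  rewrite ge0_integral_sum//; last 2 first.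
  - by move=> m; apply/measurable_EFinP; apply: measurable_funM.
  - by move=> m y _; rewrite lee_fin mulr_ge0.
  rewrite -sumEFin; apply: eq_bigr => m _; rewrite mulrA EFinM -integral_tree//; last first.
    exact: bad_ge0.
  rewrite -ge0_integralZl ?lee_fin//.
  - by apply/measurable_EFinP.
  - by move=> y _; rewrite lee_fin.
rewrite -lee_fin -sumEFin EFinM EFin_hmass// -ge0_integralZl//; last 2 first.
- by apply/measurable_EFinP; exact: measurable_hat.
- by move=> y _; rewrite lee_fin hat_ge0.
rewrite (eq_bigr (fun n : 'I_L => \int[mu]_y (tree n (F n y) x0 4)%:E)%E); last first.
  move=> n _; apply/esym; apply: integral_tree_gen => //.
  by move=> p q; exact: FG.
rewrite -ge0_integral_sum//; last 2 first.
- by move=> n; apply/measurable_EFinP; exact: measurable_tree.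
- by move=> n y _; rewrite lee_fin tree_ge0.
apply: le_integral_ge0 => y _.
  by apply: sume_ge0 => n _; rewrite lee_fin tree_ge0.
by rewrite sumEFin -EFinM lee_fin; exact: sum_tree_bad_hat.
Qed.

Lemma sum_tree_W L : \sum_(n < L) tree n (W n) x0 4 <= 2 * N x0 4 + 2 * M x0 4.
Proof.
apply: le_trans (lerD (sum_tree_energy L) (sum_tree_bad L)).
rewrite -big_split/=; apply: ler_sum => n _; rewrite -treeDl.
by apply: ler_tree => p; rewrite /W -big_split/=; apply: ler_sum => m _; rewrite mulrDr.
Qed.

Let C1 : R := (1 + lam) ^+ 2 * (1 + 2 * k * lam).
Let c0 : R := 96 * lam * k.
(** The coefficients delivered by [sqr_le_of_amgm] in [alpha_sq_le]. The factor [c0] comes from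
    replacing [96 / M x r] by [c0 / N p q]. *)
Definition square_const : R := 4 * c0 ^+ 2 * C1 + 16 * c0 + 16 * c0 ^+ 2 * lam ^+ 2.

Let k0 : 0 < k. Proof. exact: lt_le_trans k1. Qed.
Let C1_ge0 : 0 <= C1.
Proof. by rewrite mulr_ge0 ?sqr_ge0// addr_ge0// !mulr_ge0// ltW. Qed.
Let c0_gt0 : 0 < c0. Proof. by rewrite mulr_gt0// mulr_gt0. Qed.

Lemma square_const_ge0 : 0 <= square_const.
Proof.
have s2 := sqr_ge0 c0; have l2 := sqr_ge0 lam; have c := ltW c0_gt0.
apply: addr_ge0; first apply: addr_ge0.
- by apply: mulr_ge0 => //; exact: mulr_ge0.
- exact: mulr_ge0.
- by apply: mulr_ge0 => //; exact: mulr_ge0.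
Qed.

Lemma osc_split p q t : 0 < q -> 0 < t ->
  osc p q <= t * N p q + C1 / (4 * t) * energy p q + 2 * (bad p q * M p q).
Proof.
move=> q0 t0; rewrite /bad; have [dl|_] := leP (dens p q) lam.
  have t20 : 0 < 2 * t by rewrite mulr_gt0.
  have := osc_energy rmu rnu k1 hk nu_gt0 q0 t20 dl.
  rewrite (_ : 2 * t / 2 = t); last by field.
  by rewrite (_ : 2 * (2 * t) = 4 * t) -/C1; [lra|ring].
have := osc_le rmu rnu nu_gt0 p q0.
have : 0 <= t * N p q by rewrite mulr_ge0 ?hmass_ge0// ltW.
have : 0 <= C1 / (4 * t) * energy p q.
  by rewrite mulr_ge0// divr_ge0// mulr_ge0// ltW.
lra.
Qed.

(** Spreads the node quantities [W] into a function of the point whose [nu]-integral is again their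
    weighted sum. *)
Definition error n x : R := tree n (fun p q => W n p q / N p q * hat p q x) x0 4.

(** The grid node [p] nearest [x] has tree weight at least [1/4], and its hat is at least [1/2] at
    [x]; hence the factor [8]. The oscillation bound at [p] is then split into energy and bad mass,
    with [t] left free for [sqr_le_of_amgm]. *)
Lemma alpha_sq_le n r x : E x -> tile n r ->
  (alpha_s mu nu (x - r) (x + r) * alpha_s mu nu (x - r) (x + r) <=
   (square_const * (8 * error n x + 2^-1 ^+ n))%:E)%E.
Proof.
move=> Ex nr; have r01 := tile_sub01 nr; have /andP[r0 r1] := r01.
set q := rn n; have q0 : 0 < q := rn_gt0 n.
have rq : q / 8 <= r < q / 4.
  move/tileE: nr; rewrite exprS /q rnE => /andP[h1 h2]; apply/andP; split; lra.
have WN0 p t : 0 <= W n p t / N p t by rewrite divr_ge0 ?hmass_ge0.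
have [p px pe] : exists2 p, `|p - x| <= q / 2 &
    hat x0 4 p * (W n p q / N p q * hat p q x) <= error n x.
  apply: (@tree_grid_near R n (fun p q => W n p q / N p q * hat p q x)) => //.
  by move=> p t; rewrite mulr_ge0 ?hat_ge0.
have hp : 4^-1 <= hat x0 4 p.
  apply: le_trans (hat_ge x0 4 p); have := ler_distD x p x0; have := E_loc Ex.
  have := rn_le4 n; rewrite -/q => q4 e1 e2.
  have : `|p - x0| / 4 <= 3 / 4 by rewrite ler_pM2r//; lra.
  lra.
have hx : 2^-1 <= hat p q x.
  apply: le_trans (hat_ge p q x); rewrite distrC.
  have : `|p - x| / q <= 2^-1 by rewrite ler_pdivrMr// mulrC.
  lra.
have WE : W n p q / N p q <= 8 * error n x.
  have h1 := ler_wpM2l (WN0 p q) hx; have w0 := WN0 p q.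
  have h2 : 4^-1 * (W n p q / N p q * 2^-1) <= hat x0 4 p * (W n p q / N p q * hat p q x).
    by rewrite ler_pM// mulr_ge0.
  lra.
have Np := nu_gt0 p q0; have Nx := nu_gt0 x r0.
have NM : N x r <= lam * M x r by exact: E_lo.
have Mx : 0 < M x r by rewrite -(pmulr_rgt0 _ lam0); exact: lt_le_trans NM.
have dp : dens p q <= lam.
  apply: (E_hi Ex); first by rewrite q0 rn_le4.
  by rewrite distrC; lra.
have tp : tch p q = 1.
  rewrite /touches; case: asboolP => // h; exfalso; apply: h; exists x => //.
  by rewrite distrC; lra.
have Minv : 96 / M x r <= c0 / N p q.
  rewrite ler_pdivrMr// mulrAC ler_pdivlMr//.
  have Npx : N p q <= k * N x r.
    by move/andP: rq => [rq1 rq2]; apply: hk => //; lra.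
  rewrite (_ : c0 * M x r = 96 * (k * (lam * M x r))); last by rewrite /c0; ring.
  rewrite ler_pM2l//; apply: le_trans Npx _; by rewrite ler_pM2l.
have a0 := alpha_s_ge0 x rmu rnu r0; have a2 := alpha_s_le2 x rmu rnu r0.
have af : alpha_s mu nu (x - r) (x + r) \is a fin_num.
  by rewrite ge0_fin_numE// (le_lt_trans a2)// ltry.
rewrite -(fineK af) -EFinM lee_fin -expr2; set a := fine _.
have aE : alpha_s mu nu (x - r) (x + r) = a%:E by rewrite fineK.
rewrite aE !lee_fin in a0 a2.
pose Se := \sum_(m < n) 2^-1 ^+ m * tree m energy p q.
pose Sb := \sum_(m < n) 2^-1 ^+ m * tree m (fun s t => bad s t * M s t) p q.
have Se0 : 0 <= Se.
  by apply: sumr_ge0 => m _; rewrite mulr_ge0 ?(ltW (half_lt1 _)) ?tree_ge0.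
have Sb0 : 0 <= Sb.
  by apply: sumr_ge0 => m _; rewrite mulr_ge0 ?(ltW (half_lt1 _)) ?tree_ge0.
have WS : W n p q = Se + Sb.
  by rewrite /W /Se /Sb -big_split/=; apply: eq_bigr => m _; rewrite tp mul1r mulrDr.
have key t : 0 < t -> a <= 2 * c0 * t + c0 * C1 / 4 * (Se / N p q) / t +
    2 * c0 * (Sb / N p q) + 2 * c0 * lam * 2^-1 ^+ n.
  move=> t0; have := alpha_s_le_osc rmu rnu nu_gt0 n rq px Mx.
  rewrite aE lee_fin => h; apply: le_trans h _.
  set S := \sum_(m < n) _.
  have SS : S <= 2 * t * N p q + C1 / (4 * t) * Se + 2 * Sb.
    have S1 : S <= \sum_(m < n) 2^-1 ^+ m * (t * N p q + C1 / (4 * t) * tree m energy p q +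
        2 * tree m (fun s t => bad s t * M s t) p q).
      apply: ler_sum => m _; rewrite ler_wpM2l ?(ltW (half_lt1 _))//.
      rewrite -(tree_hmass m p rnu q0) -!treeZ -!treeDl; apply: ler_tree => s.
      by apply: osc_split => //; rewrite divr_gt0// exprn_gt0.
    apply: le_trans S1 _.
    under eq_bigr do rewrite !mulrDr.
    rewrite !big_split/= -mulr_suml /Se /Sb !mulr_sumr !lerD//.
    - rewrite -mulrA ler_wpM2r ?geom_sum// mulr_ge0// ltW//.
    - by apply: ler_sum => m _; rewrite mulrCA.
    - by apply: ler_sum => m _; rewrite mulrCA.
  have MN : M p q <= lam * N p q 
    by rewrite (densE mu nu_gt0 p q0) mulrC ler_wpM2r// ltW.
  have n0 := half_lt1 (R := R) n.
  have S2 : S + 2 * 2^-1 ^+ n * M p q <= 2 * t * N p q + C1 / (4 * t) * Se + 2 * Sb +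
      2 * 2^-1 ^+ n * (lam * N p q).
    by rewrite lerD// ler_wpM2l// mulr_ge0// ltW.
  have S0 : 0 <= S + 2 * 2^-1 ^+ n * M p q.
    rewrite addr_ge0//; last by rewrite mulr_ge0 ?hmass_ge0// mulr_ge0// ltW.
    apply: sumr_ge0 => m _; rewrite mulr_ge0 ?(ltW (half_lt1 _))//.
    by apply: tree_ge0 => s; exact: osc_ge0.
  have M0 : 0 <= 96 / M x r by rewrite divr_ge0// ltW.
  apply: le_trans (ler_pM M0 S0 Minv S2) _.
  by rewrite le_eqVlt; apply/orP; left; apply/eqP; field; rewrite !gt_eqF.
have aa : 0 <= a <= 2 by rewrite a0 a2.
have c0' := ltW c0_gt0; have Np' := ltW Np; have h0' := ltW (half_lt1 (R := R) n).
have s0 : 0 <= c0 * C1 / 4 * (Se / N p q).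
  by apply: mulr_ge0; apply: divr_ge0 => //; exact: mulr_ge0.
have v0 : 0 <= 2 * c0 * (Sb / N p q).
  by apply: mulr_ge0; [exact: mulr_ge0|exact: divr_ge0].
have w0 : 0 <= 2 * c0 * lam * 2^-1 ^+ n.
  by apply: mulr_ge0 => //; apply: mulr_ge0 (ltW lam0); exact: mulr_ge0.
have c2 : 0 < 2 * c0 by rewrite mulr_gt0.
apply: le_trans (sqr_le_of_amgm c2 s0 v0 w0 aa key) _.
set h := 2^-1 ^+ n; have h0 : 0 < h by exact: half_lt1.
have h1 : h <= 1 by have := half_mono (R := R) (leq0n n); rewrite expr0.
set se := Se / N p q; set sb := Sb / N p q.
have se0 : 0 <= se by rewrite divr_ge0// ltW.
have sb0 : 0 <= sb by rewrite divr_ge0// ltW.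
have ss : se + sb <= 8 * error n x by rewrite /se /sb -mulrDl -WS.
apply: (@le_trans _ _ (square_const * (se + sb + h))); last first.
  by rewrite ler_wpM2l ?square_const_ge0// lerD2r.
have P1 : 0 <= 4 * c0 ^+ 2 * C1 by rewrite mulr_ge0// mulr_ge0// sqr_ge0.
have P2 : 0 <= 16 * c0 by rewrite mulr_ge0// ltW.
have P3 : 0 <= 16 * c0 ^+ 2 * lam ^+ 2 by rewrite mulr_ge0 ?sqr_ge0// mulr_ge0// sqr_ge0.
have E1 : 8 * (2 * c0) * (c0 * C1 / 4 * se) = 4 * c0 ^+ 2 * C1 * se by field.
have E2 : 8 * (2 * c0 * sb) = 16 * c0 * sb by ring.
have E3 : 4 * (2 * c0 * lam * h) ^+ 2 = 16 * c0 ^+ 2 * lam ^+ 2 * (h * h) by ring.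
have E4 : h * h <= h by rewrite ler_piMl// ltW.
rewrite E1 E2 E3 /square_const; move: P1 P2 P3.
set A := 4 * c0 ^+ 2 * C1; set B := 16 * c0; set C := 16 * c0 ^+ 2 * lam ^+ 2 => A0 B0 C0.
have := mulr_ge0 A0 sb0; have := mulr_ge0 A0 (ltW h0); have := mulr_ge0 B0 se0.
have := mulr_ge0 B0 (ltW h0); have := mulr_ge0 C0 se0; have := mulr_ge0 C0 sb0.
have := ler_wpM2l C0 E4; lra.
Qed.

(** The series of the [error n] has finite [nu]-integral, hence converges almost everywhere, and it
    dominates the square function on [E] up to a geometric series. *)
Lemma negligible_infinite_square : nu.-negligible (E `&` [set x | sq_fun mu nu x = +oo%E]).
Proof.
have e0 n x : 0 <= error n x.
  by apply: tree_hat_ge0 => p t; rewrite divr_ge0 ?hmass_ge0.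
have me n : measurable_fun [set: RT] (EFin \o (error n : RT -> R)).
  by apply/measurable_EFinP; exact: measurable_tree_hat.
pose f (x : RT) := (\sum_(0 <= n <oo) (error n x)%:E)%E.
have intf : (\int[nu]_x f x <= (2 * N x0 4 + 2 * M x0 4)%:E)%E.
  rewrite /f integral_nneseries//; last by move=> n x _; rewrite lee_fin.
  have -> : (\sum_(0 <= n <oo) \int[nu]_x (error n x)%:E =
      \sum_(0 <= n <oo) (tree n (W n) x0 4)%:E)%E.
    apply: eq_eseriesr => n _; rewrite /error integral_tree//; last first.
      by move=> p t; rewrite divr_ge0 ?hmass_ge0.
    congr EFin; apply: eq_tree => p; rewrite divfK// gt_eqF// nu_gt0//.
  apply: lime_le; first by apply: is_cvg_nneseries => n _ _; rewrite lee_fin tree_ge0.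
  by apply: nearW => L; rewrite big_mkord sumEFin lee_fin; exact: sum_tree_W.
have f0 x : (0 <= f x)%E by apply: nneseries_ge0 => n _ _; rewrite lee_fin.
have mf : measurable_fun [set: RT] f.
  by apply: ge0_emeasurable_sum => [n x _ _|n _]; [rewrite lee_fin|exact: me].
have If : nu.-integrable setT f.
  apply/integrableP; split => //; apply: le_lt_trans (ltry (2 * N x0 4 + 2 * M x0 4)).
  apply: le_trans intf; rewrite le_eqVlt; apply/orP; left; apply/eqP.
  by apply: eq_integral => x _; rewrite gee0_abs.
have := integrable_ae measurableT If; apply: negligibleS => x [Ex sx] /= fin.
have {}fin := fin I; move: sx; apply/eqP; rewrite -ltey.
have sc := square_const_ge0.
have u0 n : 0 <= square_const * (8 * error n x + 2^-1 ^+ n).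
  by rewrite mulr_ge0// addr_ge0 ?mulr_ge0// ltW// half_lt1.
apply: le_lt_trans (sq_fun_le rmu rnu u0 (fun n r => @alpha_sq_le n r x Ex)) _.
have h0 n : (0 <= (2^-1 ^+ n : R)%:E)%E by rewrite lee_fin ltW// half_lt1.
have g0 n : (0 <= (error n x)%:E)%E by rewrite lee_fin.
have g80 n : (0 <= 8%:E * (error n x)%:E)%E by rewrite mule_ge0.
have -> : (\sum_(0 <= n <oo) (square_const * (8 * error n x + 2^-1 ^+ n))%:E =
    \sum_(0 <= n <oo) (square_const%:E * (8%:E * (error n x)%:E + (2^-1 ^+ n)%:E)))%E.
  by apply: eq_eseriesr => n _; rewrite EFinM EFinD EFinM.
rewrite nneseriesZl; last by move=> n _; rewrite adde_ge0.
rewrite nneseriesD//.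
rewrite nneseriesZl; last by move=> n _.
rewrite -/(f x) lte_mul_pinfty ?lee_fin//.
apply: lte_add_pinfty.
  by rewrite lte_mul_pinfty// -ge0_fin_numE.
apply: (@le_lt_trans _ _ 2%:E); last exact: ltry.
apply: lime_le; first by apply: is_cvg_nneseries.
by apply: nearW => L; rewrite big_mkord sumEFin lee_fin geom_sum.
Qed.

End FiniteSquare.

(** * Conclusion *)


Section Assembly.
Context {R : realType}.
Implicit Types (x y z r p q t e c : R).
Notation RT := (measurableTypeR R).
Implicit Types mu nu m : {measure set RT -> \bar R}.

Lemma negligible_le_measure (m1 m2 : {measure set RT -> \bar R}) (A : set RT) :
  (forall B, measurable B -> (m1 B <= m2 B)%E) -> m2.-negligible A -> m1.-negligible A.
Proof.
move=> le12 [B [mB B0 AB]]; exists B; split => //; apply/eqP.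
by rewrite eq_le measure_ge0 andbT -B0 le12.
Qed.

Lemma negligible_dominates (m1 m2 : {measure set RT -> \bar R}) (A : set RT) :
  m1 `<< m2 -> m2.-negligible A -> m1.-negligible A.
Proof.
move=> dom [B [mB B0 AB]]; exists B; split => //; apply: (dom B) => // C mC CB.
by apply/eqP; rewrite eq_le measure_ge0 andbT -B0 le_measure ?inE.
Qed.

(** The radius [30] only has to contain every ball used below: centres within [1 + 12] of [c] and
    radii at most [12]. *)
Lemma negligible_small_ratio (m1 m2 : {measure set RT -> \bar R}) c K (A : set R) :
  radon m2 -> 0 <= K ->
  (forall j x, A x -> exists i : R * R, [/\ ball i.1 i.2 x,
    ball i.1 i.2 `<=` ball c 30 &
    (m1 (ball i.1 i.2) <= (K / j.+1%:R)%:E * m2 (ball i.1 i.2))%E]) ->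
  m1.-negligible A.
Proof.
move=> rm2 K0 h; apply: negligible_small => e e0.
have bf : m2 (ball c 30) \is a fin_num by rewrite ge0_fin_numE// radon_ball.
pose b := fine (m2 (ball c 30)); have b0 : 0 <= b by rewrite /b fine_ge0.
pose j := Num.truncn (2 * K * b / e).
pose I := [set i : R * R | ball i.1 i.2 `<=` ball c 30 /\
  (m1 (ball i.1 i.2) <= (K / j.+1%:R)%:E * m2 (ball i.1 i.2))%E].
exists (\bigcup_(i in I) ball i.1 i.2); split.
- by apply: open_measurable; apply: bigcup_open => i _; exact: ball_open.
- by move=> x /(h j)[i [xi iB im]]; exists i.
have Kj : 0 <= K / j.+1%:R by rewrite divr_ge0.
apply: le_trans (@cover_bigcup _ m1 m2 _ c 30 I Kj _ _) _.
- by move=> i [].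
- by move=> i [].
rewrite -(fineK bf) -/b -EFinM lee_fin.
rewrite (_ : 2 * (K / j.+1%:R) * b = 2 * K * b / j.+1%:R); last by ring.
rewrite ler_pdivrMr// (mulrC e) -ler_pdivrMr//; apply: ltW; exact: truncnS_gt.
Qed.

Definition center n : R := if @unpickle int n is Some z then z%:~R else 0.

Lemma center_floor x : center (pickle (Num.floor x)) <= x < center (pickle (Num.floor x)) + 1.
Proof.
by rewrite /center pickleK floor_le_tmp/= -[1]/(1%:~R) -rmorphD/= floorD1_gt.
Qed.

Section nonnull.
Variables (mu nu : {measure set RT -> \bar R}) (k : R).
Hypotheses (rmu : radon mu) (rnu : radon nu) (k1 : 1 <= k).
Hypothesis hk : comparable_hats nu k.
Hypothesis nu_gt0 : forall x r, 0 < r -> 0 < hmass nu x r.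

Local Notation M := (hmass mu).
Local Notation N := (hmass nu).
Local Notation dens := (dens mu nu).

Let k0 : 0 <= k. Proof. exact: le_trans k1. Qed.

Definition upper_dens lam x := forall p q, 0 < q <= 4 -> `|x - p| < 3 * q -> dens p q <= lam.
Definition lower_dens lam x := forall r, 0 < r < 1 -> N x r <= lam * M x r.

(** A weak-type maximal inequality: density above [j.+1] makes [nu] small relative to [mu] on the
    enlarged ball [ball p (3 * q)], which contains [x]. *)
Lemma negligible_upper c :
  nu.-negligible [set x | `|x - c| <= 1 /\ forall j, ~ upper_dens j.+1%:R x].
Proof.
have K0 : 0 <= 2 * k by rewrite mulr_ge0.
apply: (@negligible_small_ratio nu mu c (2 * k) _ rmu K0) => j x [xc /(_ j)].
move=> /existsNP[p /existsNP[q /not_implyP[/andP[q0 q4] /not_implyP[xp /negP]]]].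
rewrite -ltNge => dl; exists (p, 3 * q); split => /=.
- by rewrite /ball/= distrC.
- move=> y; rewrite /ball/= => py; have := ler_distD p c y; have := ler_distD x c p.
  rewrite (distrC c x); lra.
have q6 : 0 < 6 * q by rewrite mulr_gt0.
have -> : 3 * q = 6 * q / 2 by lra.
apply: le_trans (ball_le_hmass p rnu q6) _.
have N6 : N p (6 * q) <= k * N p q.
  by apply: hk => //; rewrite ?subrr ?normr0; lra.
apply: (@le_trans _ _ ((2 * k / j.+1%:R)%:E * (M p q)%:E)%E); last first.
  apply: lee_wpmul2l; first by rewrite lee_fin divr_ge0.
  apply: le_trans (hmass_le_ball p rmu q0) _; apply: le_measure; rewrite ?inE.
  + exact: measurable_ball.
  + exact: measurable_ball.
  + by apply: le_ball; lra.
rewrite -EFinM lee_fin (densE mu nu_gt0 p q0).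
apply: (@le_trans _ _ (2 * k * N p q)); first by lra.
rewrite (_ : 2 * k / j.+1%:R * _ = 2 * k * N p q * (dens p q / j.+1%:R)); last by ring.
rewrite ler_peMr ?mulr_ge0 ?hmass_ge0// ler_pdivlMr// mul1r ltW//.
Qed.

(** The same covering argument with [mu] and [nu] exchanged. Doubling is applied to [nu] alone, to
    return from radius [r] to the half ball. *)
Lemma negligible_lower c :
  mu.-negligible [set x | `|x - c| <= 1 /\ forall j, ~ lower_dens j.+1%:R x].
Proof.
have K0 : 0 <= 4 * k by rewrite mulr_ge0.
apply: (@negligible_small_ratio mu nu c (4 * k) _ rnu K0) => j x [xc /(_ j)].
move=> /existsNP[r /not_implyP[/andP[r0 r1] /negP]].
rewrite -ltNge => dl; exists (x, r / 2); have r20 : 0 < r / 2 by rewrite divr_gt0.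
split => /=; first exact: ballxx.
- move=> y; rewrite /ball/= => xy; have := ler_distD x c y; rewrite (distrC c x); lra.
apply: le_trans (ball_le_hmass x rmu r0) _.
have N2 : N x r <= k * N x (r / 2) by apply: hk => //; rewrite ?subrr ?normr0; lra.
apply: (@le_trans _ _ ((4 * k / j.+1%:R)%:E * (N x (r / 2))%:E)%E); last first.
  apply: lee_wpmul2l; first by rewrite lee_fin divr_ge0.
  exact: hmass_le_ball.
rewrite -EFinM lee_fin.
apply: (@le_trans _ _ (2 / j.+1%:R * (k * N x (r / 2)))); last first.
  rewrite (_ : 4 * k / j.+1%:R * _ = 2 * (2 / j.+1%:R * (k * N x (r / 2)))); last by ring.
  by rewrite ler_peMl ?ler1n// mulr_ge0 ?divr_ge0// mulr_ge0 ?hmass_ge0.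
apply: le_trans (_ : _ <= 2 / j.+1%:R * (j.+1%:R * M x r)) _.
  by rewrite mulrA divfK// pnatr_eq0.
by rewrite ler_wpM2l ?divr_ge0// (le_trans (ltW dl)).
Qed.

Lemma infinite_square_negligible (mu_a : {measure set RT -> \bar R}) :
  (forall B, measurable B -> (mu_a B <= mu B)%E) -> mu_a `<< nu ->
  mu_a.-negligible [set x | sq_fun mu nu x = +oo%E].
Proof.
move=> le_a dom.
pose E n j : set R := [set x | [/\ `|x - center n| <= 1, upper_dens j.+1%:R x &
  lower_dens j.+1%:R x]].
pose B1 n := [set x | `|x - center n| <= 1 /\ forall j, ~ upper_dens j.+1%:R x].
pose B2 n := [set x | `|x - center n| <= 1 /\ forall j, ~ lower_dens j.+1%:R x].
apply: (@negligibleS _ _ _ mu_a (\bigcup_n (B1 n `|` B2 n `|`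
    \bigcup_j (E n j `&` [set x | sq_fun mu nu x = +oo%E])))); last first.
  apply: negligible_bigcup => n; apply: negligibleU; first apply: negligibleU.
  - by apply: (negligible_dominates dom); exact: negligible_upper.
  - by apply: (negligible_le_measure le_a); exact: negligible_lower.
  apply: negligible_bigcup => j; apply: (negligible_dominates dom).
  by apply: (@negligible_infinite_square _ mu nu k rmu rnu k1 hk nu_gt0 (E n j) j.+1%:R
    (center n)) => // [x p q [_ h _]|x r [_ _ h]|x []//]; exact: h.
move=> x sx; exists (pickle (Num.floor x)) => //.
have xc : `|x - center (pickle (Num.floor x))| <= 1.
  by have /andP[h1 h2] := center_floor x; rewrite ger0_norm ?subr_ge0//; lra.
have [[j1 h1]|/forallNP n1] := pselect (exists j, upper_dens j.+1%:R x); last first.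
  by left; left; split.
have [[j2 h2]|/forallNP n2] := pselect (exists j, lower_dens j.+1%:R x); last first.
  by left; right; split.
right; exists (maxn j1 j2) => //; split => //; split => //.
  move=> p q q4 xp; apply: le_trans (h1 p q q4 xp) _.
  by rewrite ler_nat ltnS leq_maxl.
move=> r r1; apply: le_trans (h2 r r1) _.
by rewrite ler_wpM2r ?hmass_ge0// ler_nat ltnS leq_maxr.
Qed.

Lemma finite_square_negligible (Z : set RT) : measurable Z -> nu Z = 0%E ->
  mu.-negligible (Z `&` [set x | (sq_fun mu nu x < +oo)%E]).
Proof.
move=> mZ nuZ; have K1_gt0 : 0 < 2048 * k ^+ 3.
  apply: mulr_gt0; first by rewrite ltr0n.
  by apply: exprn_gt0; exact: lt_le_trans k1.
have dK := @defect_le _ mu nu k rmu rnu k1 hk nu_gt0.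
move: (2048 * k ^+ 3) K1_gt0 dK => K1 K1_gt0 dK.
(* The trees have radius [1/8] and serve points within [1/16] of their centre, hence a grid of
   spacing [1/16]. *)
pose x0 n : R := center n / 16.
pose E n j : set R := [set x | `|x - x0 n| < 2^-1 ^+ 3 / 2 /\
  (sq_fun mu nu x <= j%:R%:E)%E].
apply: (@negligibleS _ _ _ mu (\bigcup_n \bigcup_j (E n j `&` Z))); last first.
  apply: negligible_bigcup => n; apply: negligible_bigcup => j.
  apply: (@negligible_singular _ mu nu K1 rmu rnu nu_gt0 K1_gt0 dK (E n j) j%:R (x0 n)) => //.
  - by move=> e [].
  - by move=> e [].
move=> x [Zx /= sx]; have := center_floor (16 * x).
set n := pickle _ => /andP[h1 h2]; exists n => //.
have [j hj] : exists j : nat, (sq_fun mu nu x <= j%:R%:E)%E.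
  move: sx; case: (sq_fun mu nu x) => [s _|//|_]; last by exists 0%N; rewrite leNye.
  exists (Num.truncn s).+1; rewrite lee_fin ltW//; exact: truncnS_gt.
exists j => //; split => //; split => //.
have -> : 2^-1 ^+ 3 / 2 = 1 / 16 :> R by rewrite !exprS expr0; lra.
by rewrite /x0 ger0_norm; lra.
Qed.

End nonnull.

(** * The degenerate case of a vanishing reference measure *)

Section null.
Variables (mu nu : {measure set RT -> \bar R}).
Hypotheses (rmu : radon mu) (rnu : radon nu).
Hypothesis nu0 : nu setT = 0%E.

Lemma null_hmass x r : 0 < r -> hmass nu x r = 0.
Proof.
move=> r0; apply/le_anti; rewrite hmass_ge0 andbT -lee_fin.
apply: le_trans (hmass_le_ball x rnu r0) _.
apply: (@le_trans _ _ (nu setT)); last by rewrite nu0.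
by apply: le_measure; rewrite ?inE//; exact: measurable_ball.
Qed.

(** The normalised [nu] is zero, so testing with half the hat gives alpha-numbers at least [1] at
    every scale. *)
Lemma null_sq_fun x : (forall r, 0 < r -> 0 < hmass mu x r) -> sq_fun mu nu x = +oo%E.
Proof.
move=> M0; apply/eqyP => A A0.
have u0 (n : nat) : 0 <= 1 :> R by [].
have ua K n r : (n < K)%N -> tile n r -> (1%:E <=
    alpha_s mu nu (x - r) (x + r) * alpha_s mu nu (x - r) (x + r) :> \bar R)%E.
  move=> _ /tile_sub01 /andP[r0 _]; have Mx := M0 r r0.
  have lip y z : `|2^-1 * hat x r y - 2^-1 * hat x r z| <= `|y - z| / (2 * r).
    rewrite -mulrBr normrM gtr0_norm ?invr_gt0// invfM mulrCA ler_wpM2l ?invr_ge0//.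
    exact: hat_lip.
  have z0 y : ~ ball x r y -> 2^-1 * hat x r y = 0.
    move=> yN; rewrite hat_eq0 ?mulr0// leNgt; apply/negP => yx; apply: yN.
    by rewrite /ball/= distrC.
  have := alpha_s_lb rmu rnu r0 lip z0; rewrite /discr null_hmass// invr0 mulr0 subr0.
  rewrite RintegralZl//; last exact: integrable_hat.
  rewrite -/(hmass mu x r) mulrA divff// mul1r divff ?gt_eqF// normr1 => a1.
  by rewrite -[leLHS]mule1 lee_pmul.
pose K := Num.truncn (2 * A); have := sq_fun_ge rmu rnu u0 (@ua K.+1).
apply: le_trans; rewrite lee_fin sumr_const card_ord -mulr_natl mulr1.
by rewrite mulrC ler_pdivlMr// mulrC ltW// truncnS_gt.
Qed.

(** A finite square function forces some hat of [mu] at [x] to have mass zero. Such points are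
    covered by [mu]-null balls, so the covering lemma applies with ratio [0] and [mu] in both
    roles. *)
Lemma null_finite_square : mu.-negligible [set x | (sq_fun mu nu x < +oo)%E].
Proof.
pose A n : set R := [set x | `|x - center n| <= 1 /\ exists2 r, 0 < r <= 1 & hmass mu x r = 0].
apply: (@negligibleS _ _ _ mu (\bigcup_n A n)); last first.
  apply: negligible_bigcup => n.
  apply: (@negligible_small_ratio mu mu (center n) 0) => // j x [xc [r /andP[r0 r1] h]].
  exists (x, r / 2); split => /=; first by apply: ballxx; rewrite divr_gt0.
  - move=> y; rewrite /ball/= => xy; have := ler_distD x (center n) y.
    rewrite (distrC (center n) x); lra.
  by apply: le_trans (ball_le_hmass x rmu r0) _; rewrite h mulr0 mul0r mul0e.
move=> x /= sx; exists (pickle (Num.floor x)) => //; split.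
  by have /andP[h1 h2] := center_floor x; rewrite ger0_norm ?subr_ge0//; lra.
apply: contrapT => h; move: sx; rewrite null_sq_fun ?ltxx// => r r0.
have m0 : 0 < Num.min r 1 by rewrite lt_min r0 ltr01.
have Mm : 0 < hmass mu x (Num.min r 1).
  rewrite lt_neqAle hmass_ge0 andbT eq_sym; apply/eqP => h0; apply: h.
  by exists (Num.min r 1) => //; rewrite m0 ge_min lexx orbT.
apply: lt_le_trans Mm _; rewrite -lee_fin !EFin_hmass//.
apply: le_integral_ge0 => y _; rewrite lee_fin ?hat_ge0//.
rewrite /hat ge_max le_max lexx/= le_max; apply/orP; right; rewrite lerD2l lerN2.
by rewrite ler_wpM2l// lef_pV2 ?posrE// ge_min lexx.
Qed.

End null.
End Assembly.

Theorem mainTheorem2 (R : realType)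
  (mu nu mu_a mu_s : {measure set (measurableTypeR R) -> \bar R}) :
  radon mu -> radon nu -> doubling nu ->
  (forall A, measurable A -> mu A = (mu_a A + mu_s A)%E) ->
  mu_a `<< nu -> msingular mu_s nu ->
  ({ae mu_a, forall x, (sq_fun mu nu x < +oo)%E} /\
   {ae mu_s, forall x, sq_fun mu nu x = +oo%E}).
Proof.
move=> rmu rnu dnu muE dom [Z [mZ [sZ nuZ]]].
have le_a B : measurable B -> (mu_a B <= mu B)%E by move=> mB; rewrite muE// leeDl.
have le_s B : measurable B -> (mu_s B <= mu B)%E by move=> mB; rewrite muE// leeDr.
(* Either [nu] vanishes, in which case [mu_a] vanishes by domination, or every hat has positive
   [nu]-mass and densities make sense. *)
have [[x [r [r0 h]]]|nu_gt0] := pselect (exists x r, 0 < r /\ hmass nu x r = 0).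
  have nuT := hmass_eq0_null rnu dnu r0 h; split.
    apply: (negligible_dominates dom); exists setT; split => //.
  apply: (negligible_le_measure le_s).
  apply: negligibleS (null_finite_square rmu rnu nuT) => y /= /eqP.
  by rewrite -ltey.
have {}nu_gt0 x r : 0 < r -> 0 < hmass nu x r.
  move=> r0; rewrite lt_neqAle hmass_ge0 andbT eq_sym; apply/eqP => h.
  by apply: nu_gt0; exists x, r.
have [k k1 hk] := doubling_hmass rnu dnu; split.
  apply: negligibleS (infinite_square_negligible rmu rnu k1 hk nu_gt0 le_a dom) => x /=.
  by rewrite ltey => /negP; rewrite negbK => /eqP.
(* [mu_s] ignores [Z], and the complement of [Z] is a [nu]-null set, to which the singular estimate
   for [mu] applies. *)
apply: (@negligibleS _ _ _ mu_s (Z `|` (~` Z `&` [set x | (sq_fun mu nu x < +oo)%E]))).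
  move=> x /= /eqP; rewrite -ltey => sx; have [Zx|NZx] := pselect (Z x); [by left|by right].
apply: negligibleU; first by exists Z; split.
apply: (negligible_le_measure le_s).
by apply: (finite_square_negligible rmu rnu k1 hk nu_gt0) => //; exact: measurableC.
Qed.
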